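(* Given $N\in(1,\infty)$ and $K>0$, suppose that the compact measured length space $(X,d,\nu)$ has $N$-Ricci curvature bounded below by $K$. Then for any nonnegative Lipschitz function $\rho_0$ on $X$ with $\int_X\rho_0\,d\nu=1$, one has $$N-N\int_X\rho_0^{1-\frac1N}\,d\nu\ \le\ \frac{1}{2K}\left(\frac{N-1}{N}\right)^2\int_X\frac{\rho_0^{-1-\frac2N}}{\frac13+\frac23\rho_0^{-\frac1N}}\,|\nabla^-\rho_0|^2\,d\nu .$$
   Context: A compact measured length space $(X,d,\nu)$ is a compact length space $(X,d)$ with a Borel probability measure $\nu$. For a Lipschitz function $f$ on $X$, $|\nabla^-f|(x)=\limsup_{y\to x}\frac{[f(x)-f(y)]_+}{d(x,y)}$, $a_+=\max(a,0)$ (and $|\nabla^- f|(x)=0$ if $x$ is isolated). At points where $\rho_0=0$ one has $|\nabla^-\rho_0|=0$, and the integrand on the right is taken to be $0$ there. Transport notation: $\Gamma$ is the set of minimizing constant-speed geodesics $\gamma:[0,1]\to X$, $e_t(\gamma)=\gamma(t)$, $E=(e_0,e_1)$. A transference plan between $\mu_0,\mu_1\in P(X)$ is $\pi\in P(X\times X)$ with marginals $\mu_0,\mu_1$; it is optimal if it minimizes $\int d(x_0,x_1)^2\,d\pi$. An optimal dynamical transference plan from $\mu_0$ to $\mu_1$ is a Borel probability measure $\Pi$ on $\Gamma$ such that $\pi=E_*\Pi$ is an optimal transference plan between $\mu_0$ and $\mu_1$. Disintegrations: $d\pi(x_0,x_1)=d\pi(x_1|x_0)\,d\mu_0(x_0)=d\pi(x_0|x_1)\,d\mu_1(x_1)$.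 $\mathcal{DC}_N$ is the set of continuous convex $U:[0,\infty)\to\mathbb{R}$ with $U(0)=0$ such that $\lambda\mapsto\lambda^NU(\lambda^{-N})$ is convex on $(0,\infty)$. $U'(\infty)=\lim_{r\to\infty}U(r)/r$, $U'(0)=\lim_{r\to0^+}U(r)/r$, and $U_\nu(\mu)=\int_XU(\rho)\,d\nu+U'(\infty)\mu_s(X)$ where $\mu=\rho\nu+\mu_s$ is the Lebesgue decomposition with respect to $\nu$ ($\infty\cdot0=0$). For $K>0$, $N\in(1,\infty)$ let $\alpha=\sqrt{\frac{K}{N-1}}\,d(x_0,x_1)$ and $\beta_t(x_0,x_1)=\left(\frac{\sin(t\alpha)}{t\sin\alpha}\right)^{N-1}$ if $\alpha\in[0,\pi]$ (with limiting values where the quotient is not defined), $\beta_t(x_0,x_1)=\infty$ if $\alpha>\pi$. $(X,d,\nu)$ has $N$-Ricci curvature bounded below by $K$ if for all $\mu_0,\mu_1\in P(X)$ with support in $\mathrm{supp}(\nu)$, with Lebesgue decompositions $\mu_0=\rho_0\nu+\mu_{0,s}$, $\mu_1=\rho_1\nu+\mu_{1,s}$, there is some optimal dynamical transference plan $\Pi$ from $\mu_0$ to $\mu_1$ such that, with $\mu_t=(e_t)_*\Pi$ and $\pi=E_*\Pi$, for all $U\in\mathcal{DC}_N$ and all $t\in[0,1]$, $$U_\nu(\mu_t)\le(1-t)\int_{X\times X}\beta_{1-t}(x_0,x_1)\,U\!\left(\tfrac{\rho_0(x_0)}{\beta_{1-t}(x_0,x_1)}\right)d\pi(x_1|x_0)\,d\nu(x_0)+t\int_{X\times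 X}\beta_t(x_0,x_1)\,U\!\left(\tfrac{\rho_1(x_1)}{\beta_t(x_0,x_1)}\right)d\pi(x_0|x_1)\,d\nu(x_1)+U'(\infty)\big((1-t)\mu_{0,s}[X]+t\mu_{1,s}[X]\big).$$ If $\beta_t(x_0,x_1)=\infty$, $\beta_tU(\rho_1/\beta_t)$ is interpreted as $U'(0)\rho_1(x_1)$; similarly $\beta_{1-t}U(\rho_0/\beta_{1-t})$ is interpreted as $U'(0)\rho_0(x_0)$ if $\beta_{1-t}=\infty$. *)

(* Defs.v *)
From HB Require Import structures.
From mathcomp Require Import all_boot all_order all_algebra.
From mathcomp Require Import all_classical all_reals all_analysis.

Set Implicit Arguments.
Unset Strict Implicit.
Unset Printing Implicit Defensive.

Import Order.TTheory GRing.Theory Num.Theory.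
Import numFieldNormedType.Exports.

Local Open Scope classical_set_scope.
Local Open Scope ring_scope.

(* Measurable types are pointed in MathComp-Analysis, so a metric space with a
   Borel sigma-algebra has to be pointed too; the base point plays no role. *)
#[short(type="pmetricType")]
HB.structure Definition PointedMetric (K : numDomainType) :=
  { M of Metric K M & isPointed M }.

Notation borel T := (g_sigma_algebraType (@open T)).

Section metric_notions.
Context {R : realType} {X : metricType R}.

Definition curve_length (g : R -> X) : \bar R :=
  ereal_sup [set (\sum_(0 <= i < size s)
                   mdist (g (nth 1 (0 :: s) i)) (g (nth 1 (0 :: s) i.+1)))%:E
            | s in itv_partition 0 1].

Definition curves (x y : X) : set (R -> X) :=
  [set g | [/\ {within (`[0, 1]%classic : set R), continuous g},
               g 0 = x & g 1 = y]].

Definition length_metric : Prop := forall x y : X,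
  (mdist x y)%:E = ereal_inf [set curve_length g | g in curves x y].

Definition lipschitz_fun (f : X -> R) : Prop :=
  exists L : R, forall x y, `|f x - f y| <= L * mdist x y.

(* At an isolated point the filter x^' is improper and its limsup is -oo. *)
Definition desc_slope (f : X -> R) (x : X) : \bar R :=
  if `[< isolated [set: X] x >] then 0%E
  else limf_esup (fun y => (Num.max (f x - f y) 0 / mdist x y)%:E) x^'.

End metric_notions.

Arguments length_metric {R} X.

Section geodesics.
Context {R : realType} (X : pmetricType R).

Definition geodesic_set : set {uniform {i01 R} -> X} :=
  [set g | forall s t : {i01 R}, mdist (g s) (g t) =
    `|s%:num - t%:num| * mdist (g 0%:i01) (g 1%:i01)].

(* The space Gamma, with the topology of uniform convergence. *)
Definition geodesic : Type := geodesic_set.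

HB.instance Definition _ := Topological.copy geodesic (set_type geodesic_set).

Let cst_geodesic : geodesic_set (fun=> point).
Proof. by move=> s t; rewrite !mdistxx mulr0. Qed.

HB.instance Definition _ :=
  isPointed.Build geodesic (SigSub (mem_set cst_geodesic)).

Definition eval_at (t : {i01 R}) (g : borel geodesic) : borel X :=
  (\val (g : geodesic_set) : {uniform {i01 R} -> X}) t.

Let continuous_eval_at t : continuous (eval_at t : geodesic -> X).
Proof.
move=> g; apply: (@continuous_comp _ {uniform {i01 R} -> X} X
  (\val : geodesic_set -> _) (fun h => h t)).
  exact: initial_continuous.
move=> A; rewrite -nbhs_entourageE => -[E entE EA]; apply/uniform_nbhs.
by exists E; split=> // h /(_ t I) Eh; apply: EA; apply/xsectionP.
Qed.

Lemma measurable_eval_at t : measurable_fun setT (eval_at t).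
Proof.
apply: (@measurability _ _ _ (borel X) setT (eval_at t) (@open X)) => // _ [B oB <-].
rewrite setTI; apply: sub_sigma_algebra.
by apply: open_comp => // g _; exact: continuous_eval_at.
Qed.

HB.instance Definition _ t := isMeasurableFun.Build _ _ _ _ (eval_at t)
  (measurable_eval_at t).

Definition endpoints (g : borel geodesic) : borel X * borel X :=
  (eval_at 0%:i01 g, eval_at 1%:i01 g).

Lemma measurable_endpoints : measurable_fun setT endpoints.
Proof. by apply: measurable_fun_pair; exact: measurable_eval_at. Qed.

HB.instance Definition _ := isMeasurableFun.Build _ _ _ _ endpoints
  measurable_endpoints.

End geodesics.

Section transport.
Context {R : realType} {X : pmetricType R}.
Implicit Types (mu : probability (borel X) R)
  (p : probability (borel X * borel X)%type R).

Definition msupport mu : set X :=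
  [set x | forall U : set X, open_nbhs x U -> (0 < mu U)%E].

Definition transference_plan mu0 mu1 p : Prop := forall A : set (borel X),
  measurable A -> p (A `*` setT) = mu0 A /\ p (setT `*` A) = mu1 A.

Definition transport_cost p : \bar R :=
  (\int[p]_z ((mdist (z.1 : X) (z.2 : X) ^+ 2)%:E))%E.

Definition optimal_plan mu0 mu1 p : Prop := transference_plan mu0 mu1 p /\
  forall q, transference_plan mu0 mu1 q ->
    (transport_cost p <= transport_cost q)%E.

Definition optimal_dynamical_plan mu0 mu1
    (P : probability (borel (geodesic X)) R) : Prop :=
  optimal_plan mu0 mu1 (distribution P (@endpoints R X)).

(* dp(x0,x1) = k0(x0)(dx1) dmu0(x0), respectively k1(x1)(dx0) dmu1(x1) *)
Definition disintegration_fst mu0 p (k0 : R.-pker borel X ~> borel X) : Prop :=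
  forall C, measurable C -> (p C = \int[mu0]_x0 k0 x0 (xsection C x0))%E.

Definition disintegration_snd mu1 p (k1 : R.-pker borel X ~> borel X) : Prop :=
  forall C, measurable C -> (p C = \int[mu1]_x1 k1 x1 (ysection C x1))%E.

End transport.

Definition lebesgue_decomposition d (T : measurableType d) (R : realType)
    (nu mu : {measure set T -> \bar R}) (rho : T -> R)
    (mus : {measure set T -> \bar R}) : Prop :=
  [/\ measurable_fun setT rho, forall x, 0 <= rho x,
      exists A, [/\ measurable A, nu A = 0%E & mus (~` A) = 0%E] &
      forall A, measurable A ->
        (mu A = \int[nu]_(x in A) (rho x)%:E + mus A)%E].

Section DC.
Context {R : realType}.
Implicit Types (U : R -> R) (N K : R).

Definition DC N U : Prop :=
  [/\ {within (`[0, +oo[%classic : set R), continuous U},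
      convex_function (`[0, +oo[%classic : set R^o) U,
      U 0 = 0 &
      convex_function (`]0, +oo[%classic : set R^o)
        (fun l : R => l `^ N * U (l `^ (- N)))].

Definition Uprime_oo U : \bar R := lim ((U r / r)%:E @[r --> +oo]).

Definition Uprime_0 U : \bar R := lim ((U r / r)%:E @[r --> 0^'+]).

Definition Ufunctional d (T : measurableType d) U
    (nu : {measure set T -> \bar R}) (rho : T -> R)
    (mus : {measure set T -> \bar R}) : \bar R :=
  (\int[nu]_x (U (rho x))%:E + Uprime_oo U * mus setT)%E.

(* The quotient sin (t a) / (t sin a) is undefined when t = 0 or a is 0 or pi;
   its limit is 1 when a --> 0 (for every t), a / sin a when t --> 0, and when
   a --> pi it is 1 for t = 1 and +oo for t < 1. *)
Definition beta_of N t a : \bar R :=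
  if pi < a then +oo%E
  else if (a == 0) || (t == 1) then 1%E
  else if a == pi then +oo%E
  else if t == 0 then ((a / sin a) `^ (N - 1))%:E
  else ((sin (t * a) / (t * sin a)) `^ (N - 1))%:E.

Definition beta (X : metricType R) N K t (x0 x1 : X) : \bar R :=
  beta_of N t (Num.sqrt (K / (N - 1)) * mdist x0 x1).

(* beta U(r / beta), read as U'(0) r when beta is infinite *)
Definition betaU U (b : \bar R) (r : R) : \bar R :=
  if b is b'%:E then (b' * U (r / b'))%:E else (Uprime_0 U * r%:E)%E.

End DC.

Section curvature.
Context {R : realType} {X : pmetricType R}.

(* Two disintegrations of the same plan agree mu0- (resp. mu1-) almost
   everywhere, hence nu-almost everywhere where rho0 (resp. rho1) is nonzero,
   and elsewhere the integrand vanishes; Lebesgue decompositions are unique up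
   to nu-null modifications of the density. So neither the quantifier over
   kernels nor those over decompositions affect the meaning. *)
Definition Ricci_bounded_below (nu : probability (borel X) R) (N K : R) :=
  forall (mu0 mu1 : probability (borel X) R) (rho0 rho1 : borel X -> R)
    (mu0s mu1s : {measure set (borel X) -> \bar R}),
  msupport mu0 `<=` msupport nu -> msupport mu1 `<=` msupport nu ->
  lebesgue_decomposition nu mu0 rho0 mu0s ->
  lebesgue_decomposition nu mu1 rho1 mu1s ->
  exists (P : probability (borel (geodesic X)) R)
    (k0 k1 : R.-pker borel X ~> borel X),
  [/\ optimal_dynamical_plan mu0 mu1 P,
      disintegration_fst mu0 (distribution P (@endpoints R X)) k0,
      disintegration_snd mu1 (distribution P (@endpoints R X)) k1 &
      forall (U : R -> R) (t : {i01 R}), DC N U ->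
      exists (rhot : borel X -> R) (muts : {measure set (borel X) -> \bar R}),
        lebesgue_decomposition nu (distribution P (eval_at t)) rhot muts /\
        (Ufunctional U nu rhot muts <=
           (1 - t%:num)%:E *
             \int[nu]_x0 \int[k0 x0]_x1
               betaU U (beta N K (1 - t%:num)%R (x0 : X) (x1 : X)) (rho0 x0) +
           t%:num%:E *
             \int[nu]_x1 \int[k1 x1]_x0
               betaU U (beta N K t%:num (x0 : X) (x1 : X)) (rho1 x1) +
           Uprime_oo U *
             ((1 - t%:num)%:E * mu0s setT + t%:num%:E * mu1s setT))%E].

End curvature.

(* Main.v *)
From HB Require Import structures.
Require Import Defs.
From mathcomp Require Import all_boot all_order all_algebra.
From mathcomp Require Import all_classical all_reals all_analysis.
From mathcomp Require Import measurable_realfun.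
From mathcomp Require Import ring lra.

Import Order.TTheory GRing.Theory Num.Theory.
Import numFieldNormedType.Exports.

Local Open Scope classical_set_scope.
Local Open Scope ring_scope.

(** The curvature inequality is applied to the single energy
    [tsallis N r = - r^(1 - 1/N)] along one transport from [rho0 * nu] to [nu],
    and is differentiated at time 0. This energy lies in DC_N, its slope at
    infinity is 0, so that singular parts do not contribute, and
    [b * tsallis N (r / b) = - r^(1 - 1/N) * b^(1/N)], so the
    curvature only enters through a lower bound on [b^(1/N)]. That bound,
      [beta_t^(1/N) >= 1 + (1 - 1/N) * (1 - t^2) * a^2 / 6],
    comes from the monotonicity of [sin x * exp(x^2 / 6) / x]; it is uniform in
    [t] and [a], so that no derivative of [beta] in [t] is ever taken.

    Write [A] for the integral of [rho0^(1 - 1/N)], [F = rho0^(-1/N)], and [D0],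
    [D1] for the integrals over the plan of [F(x0) d(x0,x1)^2] and of
    [d(x0,x1)^2]. Together with the concavity of [r^(1 - 1/N)], which bounds the
    energy at time [t] by its tangent at [rho0], the curvature inequality becomes
    (lemma [displacement_inequality])
      [(1-t) (A + (2t - t^2) k D0) + t (1 + (1 - t^2) k D1)
         <= A / N + (1 - 1/N) * (integral of F(gamma_t))],  with [k = K / (6 N)].
    On the other hand [F(gamma_t) - F(gamma_0)] is controlled by the descending
    slope of [rho0] at [gamma_0] times [t * d(gamma_0, gamma_1)], and Young's
    inequality with weight [w = 1/3 + 2/3 * F] trades this for
      [t * (slope term^2 / (2 K w) + K / 2 * w * d^2)]
    (lemma [pressure_increment]). The integral of [K / 2 * w * d^2] is exactly
    [K / 6 * (D1 + 2 D0)], which is what the curvature terms give back at first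
    order in [t]; dividing by [t] and letting [t] tend to 0 leaves the asserted
    inequality (lemma [energy_dissipation]).

    Two limits make this rigorous. The slope is first replaced by its supremum
    over balls of radius [1 / (n + 1)] ([descent_rate]), a lower semicontinuous
    function for which the estimate on [F(gamma_t)] holds at all small positive
    times, and [n] tends to infinity by bounded convergence
    ([entropy_le_fisher]). The argument needs [rho0] bounded below by a positive
    constant; in general it is run for [(rho0 + e) / (1 + e)], whose Fisher
    integrand is at most [1 + e] times that of [rho0]
    ([fisher_density_scaling]). *)

(** * Concavity of powers and the Tsallis energy *)

(** The weighted arithmetic-geometric inequality for [z] and 1: average the two
    bounds obtained from [1 + y <= exp y] at the point [z^p]. *)
Lemma powR_le_affine (R : realType) (p z : R) :
  0 <= p <= 1 -> 0 <= z -> z `^ p <= 1 - p + p * z.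
Proof.
move=> /andP[p0 p1]; rewrite le_eqVlt => /predU1P[<-|z0].
  by rewrite mulr0 addr0 /powR eqxx; case: eqP => [->|_] /=; lra.
set w := z `^ p; have w0 : 0 < w by exact: powR_gt0.
have zE : z = w * expR ((1 - p) * ln z).
  by rewrite /w /powR gt_eqF// -expRD -mulrDl addrCA subrr addr0 mul1r lnK.
have oneE : 1 = w * expR (- (p * ln z)).
  by rewrite /w /powR gt_eqF// -expRD subrr expR0.
have h1 : w * (1 + (1 - p) * ln z) <= z.
  by rewrite [leRHS]zE ler_pM2l// expR_ge1Dx.
have h2 : w * (1 - p * ln z) <= 1.
  by rewrite [leRHS]oneE ler_pM2l// expR_ge1Dx.
have h3 : p * (w * (1 + (1 - p) * ln z)) <= p * z by rewrite ler_wpM2l.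
have h4 : (1 - p) * (w * (1 - p * ln z)) <= (1 - p) * 1.
  by rewrite ler_wpM2l// subr_ge0.
have : w = (1 - p) * (w * (1 - p * ln z)) + p * (w * (1 + (1 - p) * ln z)) by ring.
lra.
Qed.

Lemma powR_le_tangent (R : realType) (p a r : R) :
  0 <= p <= 1 -> 0 < a -> 0 <= r ->
  r `^ p <= (1 - p) * a `^ p + p * (a `^ (p - 1) * r).
Proof.
move=> p01 a0 r0.
have ra0 : 0 <= r / a by rewrite divr_ge0// ltW.
have rE : r = a * (r / a) by rewrite mulrCA divff ?mulr1// gt_eqF.
rewrite [X in X `^ p]rE powRM// ?(ltW a0)//.
have ap : a `^ p = a `^ (p - 1) * a.
  by rewrite -{3}(powRr1 (ltW a0)) -powRD ?subrK// (gt_eqF a0) implybT.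
have := powR_le_affine _ p _ p01 ra0.
rewrite -(ler_pM2l (powR_gt0 p a0)) => /le_trans; apply.
by rewrite mulrDr mulrC lerD2l mulrCA ler_wpM2l ?(andP p01).1// {1}ap -mulrA -rE.
Qed.

(** The graph lies below its tangent at the barycentre; the barycentre 0 is
    treated apart because there is no tangent there. *)
Lemma powR_concave (R : realType) (p t x y : R) : 0 < p <= 1 -> 0 <= t <= 1 ->
  0 <= x -> 0 <= y ->
  t * x `^ p + (1 - t) * y `^ p <= (t * x + (1 - t) * y) `^ p.
Proof.
move=> /andP[p0 p1] /andP[t0 t1'] x0 y0; have t1 : 0 <= 1 - t by rewrite subr_ge0.
have : 0 <= t * x + (1 - t) * y by rewrite addr_ge0// mulr_ge0.
rewrite le_eqVlt => /predU1P[m0|m0].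
  rewrite -m0 powR0 ?gt_eqF//.
  have /eqP : t * x + (1 - t) * y = 0 by [].
  rewrite paddr_eq0 ?mulr_ge0// !mulf_eq0 => /andP[hx hy].
  by case/orP: hx hy => /eqP-> /orP[] /eqP->;
    rewrite ?powR0 ?gt_eqF// ?(mul0r, mulr0) addr0.
set m := t * x + _ in m0 *.
have p01 : 0 <= p <= 1 by rewrite ltW.
have hx := powR_le_tangent _ p m x p01 m0 x0.
have hy := powR_le_tangent _ p m y p01 m0 y0.
have mp : m `^ p = m `^ (p - 1) * m.
  by rewrite -{3}(powRr1 (ltW m0)) -powRD ?subrK// (gt_eqF m0) implybT.
have := ler_wpM2l t1 hy; have := ler_wpM2l t0 hx.
rewrite mp; set q := m `^ _ => h1 h2.
have -> : q * m = t * ((1 - p) * (q * m) + p * (q * x)) +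
    (1 - t) * ((1 - p) * (q * m) + p * (q * y)) by rewrite /m; ring.
lra.
Qed.

Section energy.
Context {R : realType}.
Variable N : R.
Hypothesis N1 : 1 < N.

Let N0 : 0 < N. Proof. exact: lt_trans N1. Qed.
Let s01 : 0 < 1 - N^-1 <= 1.
Proof. by rewrite subr_gt0 invf_lt1// N1 gerBl invr_ge0 ltW. Qed.

Definition tsallis (r : R) : R := - r `^ (1 - N^-1).

(** Membership holds with equality in the displacement condition:
    [l^N * tsallis (l^-N) = - l] is affine. *)
Lemma DC_tsallis : DC N tsallis.
Proof.
split.
- apply/continuous_within_itvcyP; split.
    move=> x; rewrite in_itv/= andbT => x0.
    have dp : differentiable (@powR R ^~ (1 - N^-1)) x.
      by apply/derivable1_diffP; apply: derivable_powR; rewrite in_itv/= x0.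
    exact: cvgN (differentiable_continuous dp).
  rewrite /tsallis powR0 ?gt_eqF ?(andP s01).1//.
  by apply: cvgN; apply: powR_cvg0; case/andP: s01.
- move=> t x y; rewrite !inE/= !in_itv/= !andbT => x0 y0.
  have t01 : 0 <= t%:num <= 1 by apply/andP; split.
  have := powR_concave _ (1 - N^-1) t%:num x y s01 t01 x0 y0.
  rewrite -lerN2 => /le_trans; apply.
  by rewrite /tsallis /conv/= /conv/= /unstable.onem !scalerN opprD.
- by rewrite /tsallis powR0 ?oppr0// gt_eqF// (andP s01).1.
- have aff (l : R) : 0 < l -> l `^ N * tsallis (l `^ (- N)) = - l.
    move=> l0; rewrite /tsallis mulrN -powRrM -powRD ?(gt_eqF l0) ?implybT//.
    rewrite mulrBr mulr1 mulNr divff ?gt_eqF// opprK addrA subrr add0r.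
    by rewrite powRr1// ltW.
  move=> t x y; rewrite !inE/= !in_itv/= !andbT => x0 y0.
  have t01 : 0 <= t%:num <= 1 by apply/andP; split.
  rewrite !aff//.
    by rewrite /conv/= /conv/= /unstable.onem !scalerN -opprD.
  change (0 < t%:num * x + (1 - t%:num) * y).
  have [t0|t0] := ltP 0 t%:num.
    by rewrite ltr_wpDr ?mulr_gt0// mulr_ge0 ?(ltW y0)// subr_ge0 (andP t01).2.
  have -> : t%:num = 0 by apply/le_anti; rewrite t0 (andP t01).1.
  by rewrite mul0r add0r subr0 mul1r.
Qed.

Let tsallis_div (r : R) : 0 < r -> tsallis r / r = - (r `^ N^-1)^-1.
Proof.
move=> r0; rewrite /tsallis mulNr; congr (- _).
rewrite -[in LHS](powR_inv1 (ltW r0)) -powRD ?(gt_eqF r0) ?implybT//.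
by rewrite addrAC subrr add0r powRN.
Qed.

Lemma Uprime_oo_tsallis : Uprime_oo tsallis = 0%E.
Proof.
apply: cvg_lim => //; rewrite -[0%E]/((0:R)%:E); apply: cvg_EFin.
  by near=> r; rewrite fin_numE.
have : (- (r `^ N^-1)^-1) @[r --> +oo] --> (0 : R).
  rewrite -[X in _ --> X]oppr0; apply: cvgN.
  apply/gtr0_cvgV0.
    by near=> r; rewrite powR_gt0//; near: r; exact: nbhs_pinfty_gt.
  apply/cvgryPge => A; near=> r.
  have Ar : `|A| `^ N <= r by near: r; apply: nbhs_pinfty_ge; rewrite num_real.
  apply: (@le_trans _ _ ((`|A| `^ N) `^ N^-1)).
    by rewrite -powRrM divff ?gt_eqF// powRr1// ler_norm.
  apply: ge0_ler_powR => //; rewrite ?invr_ge0 ?(ltW N0)// nnegrE ?powR_ge0//.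
apply: cvg_trans; apply: near_eq_cvg; near=> r; rewrite /= tsallis_div//.
Unshelve. all: by end_near. Qed.

Lemma Uprime_0_tsallis : Uprime_0 tsallis = -oo%E.
Proof.
apply: cvg_lim => //; apply/cvgerNyP.
have : (- (r `^ N^-1)^-1) @[r --> 0^'+] --> -oo.
  apply/cvgNrNy; apply/gtr0_cvgV0.
    near=> r; rewrite invr_gt0 powR_gt0//; near: r; exact: nbhs_right_gt.
  rewrite (_ : unstable.inv_fun _ = @powR R ^~ N^-1); last first.
    by apply/funext => r; exact: invrK.
  by apply: powR_cvg0; rewrite invr_gt0.
apply: cvg_trans; apply: near_eq_cvg; near=> r; rewrite /= tsallis_div//.
Unshelve. all: by end_near. Qed.

End energy.

(** * Lower bound on the distortion coefficients *)

Section sinc.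
Context {R : realType}.
Implicit Types x t a : R.

Lemma ge0_deriv_nondecreasing (f f' : R -> R) (a b : R) : a <= b ->
  (forall x, a <= x <= b -> is_derive x 1 f (f' x)) ->
  (forall x, a <= x <= b -> 0 <= f' x) -> f a <= f b.
Proof.
move=> ab df f0; rewrite -subr_ge0.
have cf : {within `[a, b], continuous f}.
  apply: derivable_within_continuous => z; rewrite in_itv/= => zab.
  by apply: ex_derive; exact: df.
have [|c + ->] := MVT_segment ab _ cf (df:=f').
  by move=> x; rewrite in_itv/= => /andP[ax xb]; apply: df; rewrite !ltW.
by rewrite in_itv/= => cab; rewrite mulr_ge0 ?f0// subr_ge0.
Qed.

Lemma sin_sub_xcos_ge0 x : 0 <= x <= pi -> 0 <= sin x - x * cos x.
Proof.
move=> /andP[x0 xpi]; have := @ge0_deriv_nondecreasing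
  (fun x => sin x - x * cos x) (fun x => x * sin x) 0 x x0.
rewrite sin0 mul0r subrr; apply=> y /andP[y0 yx].
  by apply: is_derive_eq; rewrite /GRing.scale/=; ring.
by rewrite mulr_ge0 ?sin_ge0_pi// y0 (le_trans yx).
Qed.

(** This is [1 - x cot x >= x^2 / 3]; the difference of the two sides vanishes at
    0 and its derivative is [x / 3 * (sin x - x cos x)]. *)
Lemma sin_sub_xcos_ge x : 0 <= x <= pi ->
  x ^+ 2 / 3 * sin x <= sin x - x * cos x.
Proof.
move=> /andP[x0 xpi]; rewrite -subr_ge0.
have := @ge0_deriv_nondecreasing
  (fun x => sin x - x * cos x - x ^+ 2 / 3 * sin x)
  (fun x => x / 3 * (sin x - x * cos x)) 0 x x0.
rewrite sin0 mul0r mulr0 !subr0; apply=> y /andP[y0 yx].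
  by apply: is_derive_eq; rewrite /GRing.scale/=; field.
by rewrite mulr_ge0 ?divr_ge0 ?sin_sub_xcos_ge0// y0 (le_trans yx).
Qed.

(** The logarithm of [sin x / x] decreases at least as fast as [- x^2 / 6], its
    second order expansion at 0. *)
Lemma sinc_expR_nonincreasing x y : 0 < x -> x <= y -> y <= pi ->
  sin y * expR (y ^+ 2 / 6) / y <= sin x * expR (x ^+ 2 / 6) / x.
Proof.
move=> x0 xy ypi; rewrite -lerN2.
apply: (@ge0_deriv_nondecreasing (fun z => - (sin z * expR (z ^+ 2 / 6) / z))
  (fun z => expR (z ^+ 2 / 6) / z ^+ 2 *
     (sin z - z * cos z - z ^+ 2 / 3 * sin z)) x y xy) => z /andP[xz zy].
  have z0 : z != 0 by rewrite gt_eqF// (lt_le_trans x0).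
  have dq : is_derive z 1 (fun z : R => z ^+ 2 / 6) (z / 3).
    by apply: is_derive_eq; rewrite /GRing.scale/=; field.
  have de := is_derive1_comp (f := expR) (g := fun z : R => z ^+ 2 / 6) (is_derive_expR _) dq.
  have dV := is_deriveV z0 (is_derive_id z 1).
  have de' : is_derive z 1 (fun z : R => expR (z ^+ 2 / 6))
    (expR (z ^+ 2 / 6) * (z / 3)) by exact: de.
  have dsz := is_deriveM (is_deriveM (is_derive_sin z) de') dV.
  apply: (is_derive_eq (is_deriveN dsz)).
  rewrite /GRing.scale/=.
  rewrite -[(_ * (fun _ => _)) z]/(sin z * expR (z ^+ 2 / 6)).
  by field.
have z0 : 0 <= z by rewrite (le_trans _ xz)// ltW.
rewrite mulr_ge0 ?divr_ge0 ?expR_ge0 ?exprn_ge0// subr_ge0.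
by rewrite sin_sub_xcos_ge// z0 (le_trans zy).
Qed.

Lemma expR_le_sin_ratio t a : 0 < t < 1 -> 0 < a < pi ->
  expR ((1 - t ^+ 2) * a ^+ 2 / 6) <= sin (t * a) / (t * sin a).
Proof.
move=> /andP[t0 t1] /andP[a0 api].
have ta0 : 0 < t * a by rewrite mulr_gt0.
have taa : t * a <= a by rewrite ger_pMl// ltW.
have sa : 0 < sin a by rewrite sin_gt0_pi// a0.
rewrite ler_pdivlMr ?mulr_gt0//.
have := sinc_expR_nonincreasing (t * a) a ta0 taa (ltW api).
rewrite ler_pdivrMr// [X in _ <= X]mulrAC ler_pdivlMr// => h.
have : expR ((t * a) ^+ 2 / 6) * (expR ((1 - t ^+ 2) * a ^+ 2 / 6) * (t * sin a) * a) <=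
   expR ((t * a) ^+ 2 / 6) * (sin (t * a) * a).
  apply: le_trans (le_trans h _); last by rewrite le_eqVlt; apply/orP; left; apply/eqP; ring.
  rewrite le_eqVlt; apply/orP; left; apply/eqP.
  transitivity (sin a * (expR ((t * a) ^+ 2 / 6) * expR ((1 - t ^+ 2) * a ^+ 2 / 6)) * (t * a)).
    by ring.
  rewrite -expRD; by congr (_ * expR _ * _); field.
by rewrite ler_pM2l ?expR_gt0// ler_pM2r.
Qed.

End sinc.

Section betaU.
Context {R : realType}.
Variable N : R.
Hypothesis N1 : 1 < N.

Let N0 : 0 < N. Proof. exact: lt_trans N1. Qed.

(** One bound covers all cases of beta at an interior time: at [a = 0] it is an
    equality, and an infinite beta gives [-oo] or [r = 0]. *)
Lemma betaU_tsallis_le (t a r : R) : 0 < t < 1 -> 0 <= a -> 0 <= r ->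
  (betaU (tsallis N) (beta_of N t a) r <=
   (- (r `^ (1 - N^-1) * (1 + (1 - N^-1) * ((1 - t ^+ 2) * a ^+ 2 / 6))))%:E)%E.
Proof.
move=> /andP[t0 t1] a0 r0.
have s0 : 0 < 1 - N^-1 by rewrite subr_gt0 invf_lt1.
set c := 1 + (1 - N^-1) * _.
have oo : (Uprime_0 (tsallis N) * r%:E <= (- (r `^ (1 - N^-1) * c))%:E)%E.
  rewrite Uprime_0_tsallis//; move: r0; rewrite le_eqVlt => /predU1P[<-|r0].
    by rewrite mule0 powR0 ?gt_eqF// mul0r oppr0.
  by rewrite gt0_mulNye ?lte_fin// leNye.
rewrite /beta_of; case: (ltP pi a) => api; first exact: oo.
rewrite (lt_eqF t1) orbF; case: ifPn => [/eqP a00|aN0].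
  by rewrite /betaU mul1r divr1 /tsallis /c a00 expr0n/= mulr0 mul0r mulr0 addr0 mulr1.
case: ifPn => [_|aNpi]; first exact: oo.
rewrite (gt_eqF t0) /betaU lee_fin /tsallis mulrN lerN2.
have a01 : 0 < a < pi by rewrite lt_def aN0 a0/= lt_neqAle aNpi.
have t01 : 0 < t < 1 by rewrite t0.
have := expR_le_sin_ratio t a t01 a01.
set y := (1 - t ^+ 2) * a ^+ 2 / 6 in c oo *; set q := sin _ / _ => yq.
have q0 : 0 < q by apply: lt_le_trans yq; exact: expR_gt0.
have b0 : 0 < q `^ (N - 1) by exact: powR_gt0.
rewrite powRM ?invr_ge0 ?(ltW b0)// mulrCA ler_wpM2l ?powR_ge0//.
have -> : q `^ (N - 1) * (q `^ (N - 1))^-1 `^ (1 - N^-1) = q `^ (1 - N^-1).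
  rewrite -powRN -powRrM -powRD ?(gt_eqF q0) ?implybT//; congr (_ `^ _).
  by field; rewrite gt_eqF.
apply: (@le_trans _ _ (expR y `^ (1 - N^-1))).
  rewrite -expRM mulrC; exact: expR_ge1Dx.
apply: ge0_ler_powR => //; rewrite ?nnegrE ?expR_ge0 ?(ltW s0) ?(ltW q0)//.
Qed.

End betaU.

(** * Integration against densities and disintegrations *)

Section integral_representation.
Local Open Scope ereal_scope.
Context d (T : measurableType d) (R : realType).
Variables (m : {measure set T -> \bar R}) (Phi : (T -> \bar R) -> \bar R).
Hypothesis Phi_indic : forall A, measurable A ->
  Phi (fun x => (\1_A x)%:E) = m A.
Hypothesis PhiZ : forall (r : R) (f : T -> \bar R), (0 <= r)%R -> (forall x, 0 <= f x) ->
  measurable_fun setT f -> Phi (fun x => r%:E * f x) = r%:E * Phi f.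
Hypothesis PhiD : forall f g : T -> \bar R, (forall x, 0 <= f x) -> measurable_fun setT f ->
  (forall x, 0 <= g x) -> measurable_fun setT g ->
  Phi (fun x => f x + g x) = Phi f + Phi g.
Hypothesis Phi_lim : forall g : (T -> \bar R)^nat,
  (forall n, measurable_fun setT (g n)) -> (forall n x, 0 <= g n x) ->
  (forall x, nondecreasing_seq (g^~ x)) ->
  Phi (fun x => limn (g^~ x)) = limn (fun n => Phi (g n)).

Import HBNNSimple.

Let Phi_sum (s : seq R) (A : R -> set T) :
  (forall r, r \in s -> (0 <= r)%R) -> (forall r, measurable (A r)) ->
  Phi (fun x => \sum_(r <- s) r%:E * (\1_(A r) x)%:E) =
  \sum_(r <- s) r%:E * m (A r).
Proof.
move=> + mA; elim: s => [_|r s ih rs].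
  under eq_fun do rewrite big_nil.
  rewrite big_nil -[RHS](mul0e (Phi (cst 0))) -PhiZ//.
  by congr Phi; apply/funext => x; rewrite mul0e.
have r0 : (0 <= r)%R by rewrite rs// mem_head.
have s0 t : t \in s -> (0 <= t)%R by move=> ts; rewrite rs// inE ts orbT.
have mA1 t : measurable_fun setT (fun x => (\1_(A t) x)%:E : \bar R).
  by apply/measurable_EFinP.
under eq_fun do rewrite big_cons.
rewrite big_cons -ih// -Phi_indic// -PhiZ// PhiD//.
- by move=> x; rewrite mule_ge0// lee_fin.
- exact: measurable_funeM.
- move=> x; rewrite big_seq_cond; apply: sume_ge0 => t /andP[/s0 t0 _].
  by rewrite mule_ge0// lee_fin.
- by apply: emeasurable_sum => t; exact: measurable_funeM.
Qed.

(** A functional that is additive, positively homogeneous and continuous along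
    increasing sequences is determined by its values on indicators. Both the
    formula for densities and the two disintegration formulas are instances. *)
Lemma ge0_integral_representation f : (forall x, 0 <= f x) ->
  measurable_fun setT f -> \int[m]_x f x = Phi f.
Proof.
move=> f0 mf.
pose g := nnsfun_approx measurableT mf.
have fE x : limn (fun n => (g n x)%:E) = f x.
  by apply/cvg_lim => //; apply: cvg_nnsfun_approx.
have nd x : nondecreasing_seq (fun n => (g n x)%:E).
  by move=> a b ab; rewrite lee_fin; exact/lefP/nd_nnsfun_approx.
have mg n : measurable_fun setT (fun x => (g n x)%:E).
  exact/measurable_EFinP.
have -> : f = fun x => limn (fun n => (g n x)%:E) by apply/funext => x.
rewrite monotone_convergence//; last first.
  by move=> n x _; rewrite lee_fin.
rewrite (Phi_lim (fun n x => (g n x)%:E))//; last by move=> n x; rewrite lee_fin.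
apply: congr_lim; apply/funext => n.
rewrite integralT_nnsfun sintegralE fsbig_finite//= -Phi_sum//.
- congr Phi; apply/funext => x; rewrite sumEFin; congr EFin.
  by rewrite [RHS]fimfunE fsbig_finite.
- by move=> r; rewrite in_fset_set// inE => -[x _ <-].
Qed.

End integral_representation.

Section density.
Local Open Scope ereal_scope.
Context d (T : measurableType d) (R : realType).
Variables (nu : {measure set T -> \bar R}) (rho : T -> R).
Hypotheses (mrho : measurable_fun setT rho) (rho0 : forall x, (0 <= rho x)%R).

Let erho0 x : 0 <= (rho x)%:E. Proof. by rewrite lee_fin. Qed.
Let merho : measurable_fun setT (fun x => (rho x)%:E).
Proof. exact/measurable_EFinP. Qed.

Lemma ge0_integral_density (m : {measure set T -> \bar R}) f :
  (forall A, measurable A -> m A = \int[nu]_(x in A) (rho x)%:E) ->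
  (forall x, 0 <= f x) -> measurable_fun setT f ->
  \int[m]_x f x = \int[nu]_x ((rho x)%:E * f x).
Proof.
move=> mE f0 mf.
apply: (ge0_integral_representation _ _ _ m (fun f => \int[nu]_x ((rho x)%:E * f x))) => //.
- move=> A mA; rewrite mE// [RHS]integral_mkcond; apply: eq_integral => x _.
  by rewrite patchE indicE; case: ifPn; rewrite ?mule1 ?mule0.
- move=> r g r0 g0 mg; rewrite -ge0_integralZl_EFin//.
  + by apply: eq_integral => x _; rewrite muleCA.
  + by move=> x _; rewrite mule_ge0.
  + exact: emeasurable_funM.
- move=> g h g0 mg h0 mh; rewrite -ge0_integralD//.
  + by apply: eq_integral => x _; rewrite ge0_muleDr.
  + by move=> x _; rewrite mule_ge0.
  + exact: emeasurable_funM.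
  + by move=> x _; rewrite mule_ge0.
  + exact: emeasurable_funM.
- move=> g mg g0 nd; rewrite -monotone_convergence//.
  + apply: eq_integral => x _.
    by rewrite limeMl//; apply: ereal_nondecreasing_is_cvgn.
  + by move=> n; exact: emeasurable_funM.
  + by move=> n x _; rewrite mule_ge0.
  + by move=> x _ a b ab; apply: lee_wpmul2l => //; exact: nd.
Qed.

Let density_measure (A : set T) : \bar R := \int[nu]_(x in A) (rho x)%:E.

Let density_measure0 : density_measure set0 = 0.
Proof. exact: integral_set0. Qed.

Let density_measure_ge0 A : 0 <= density_measure A.
Proof. exact: integral_ge0. Qed.

Let density_measure_sigma_additive : semi_sigma_additive density_measure.
Proof.
move=> F mF tF mUF; rewrite /density_measure ge0_integral_bigcup//.
- by apply: is_cvg_ereal_nneg_natsum_cond => n _ _; exact: integral_ge0.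
- exact: measurable_funTS.
Qed.

Lemma exists_density_measure : exists mu : {measure set T -> \bar R},
  forall A, mu A = \int[nu]_(x in A) (rho x)%:E.
Proof.
pose mixin := isMeasure.Build _ _ _ density_measure
  density_measure0 density_measure_ge0 density_measure_sigma_additive.
pose mu : {measure set T -> \bar R} := HB.pack density_measure mixin.
by exists mu.
Qed.

(** Normalizing turns the density measure into a bundled probability without
    changing its values, as its total mass is already 1. *)
Lemma exists_density_probability : \int[nu]_x (rho x)%:E = 1 ->
  exists mu : probability T R, forall A, mu A = \int[nu]_(x in A) (rho x)%:E.
Proof.
move=> nu1; have [m mE] := exists_density_measure.
exists (mnormalize m (dirac point)) => A.
by rewrite /= /mnormalize /= !mE nu1 onee_eq0/= invr1 mule1 mE.
Qed.

End density.

Section disintegration.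
Local Open Scope ereal_scope.
Context d d' (X : measurableType d) (Y : measurableType d') (R : realType).
Variables (mu : {measure set X -> \bar R}) (k : R.-pker X ~> Y).
Variable p : {measure set (X * Y) -> \bar R}.

Lemma measurable_integral_pker (f : X * Y -> \bar R) :
  (forall z, 0 <= f z) -> measurable_fun setT f ->
  measurable_fun setT (fun x => \int[k x]_y f (x, y)).
Proof. exact: measurable_fun_integral_finite_kernel. Qed.

Let measurable_section (f : X * Y -> \bar R) x :
  measurable_fun setT f -> measurable_fun setT (fun y => f (x, y)).
Proof. by move=> mf; apply: measurableT_comp. Qed.

Lemma ge0_integral_disintegration (f : X * Y -> \bar R) :
  (forall C, measurable C -> p C = \int[mu]_x k x (xsection C x)) ->
  (forall z, 0 <= f z) -> measurable_fun setT f ->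
  \int[p]_z f z = \int[mu]_x \int[k x]_y f (x, y).
Proof.
move=> pE f0 mf.
apply: (ge0_integral_representation _ _ _ p
  (fun f => \int[mu]_x \int[k x]_y f (x, y))) => //.
- move=> A mA; rewrite pE//; apply: eq_integral => x _.
  transitivity (\int[k x]_y (\1_(xsection A x) y)%:E).
    by apply: eq_integral => y _; rewrite !indicE mem_xsection.
  by rewrite integral_indic ?setIT//; exact: measurable_xsection.
- move=> r g r0 g0 mg; rewrite -ge0_integralZl_EFin//.
  + by apply: eq_integral => x _; rewrite ge0_integralZl_EFin//; exact: measurable_section.
  + by move=> x _; exact: integral_ge0.
  + exact: measurable_integral_pker.
- move=> g h g0 mg h0 mh; rewrite -ge0_integralD//.
  + by apply: eq_integral => x _; rewrite ge0_integralD//; exact: measurable_section.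
  + by move=> x _; exact: integral_ge0.
  + exact: measurable_integral_pker.
  + by move=> x _; exact: integral_ge0.
  + exact: measurable_integral_pker.
- move=> g mg g0 nd; rewrite -monotone_convergence//.
  + by apply: eq_integral => x _; rewrite monotone_convergence// => n;
      exact: measurable_section.
  + by move=> n; exact: measurable_integral_pker.
  + by move=> n x _; exact: integral_ge0.
  + move=> x _ a b ab; apply: ge0_le_integral => //.
    * exact: measurable_section.
    * exact: measurable_section.
    * by move=> y _; exact: nd.
Qed.

End disintegration.

(** * Borel measurability on a compact metric space *)

Section metric_space.
Context {R : realType} {X : pmetricType R}.

Lemma measurable_superlevel d (T : measurableType d) (f : T -> R) :
  (forall a, measurable [set x | a < f x]) -> measurable_fun setT f.
Proof.
move=> mf; apply: (measurability _ (RGenOInfty.measurableE R)).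
move=> /= _ [_ [a ->]] <-; rewrite setTI.
rewrite [X in measurable X](_ : _ = [set x | a < f x])//.
by apply/seteqP; split => x /=; rewrite in_itv/= andbT.
Qed.

Lemma open_borel (A : set X) : open A -> measurable (A : set (borel X)).
Proof. exact: sub_sigma_algebra. Qed.

Lemma ball_mdist (x y : X) e : ball x e y = (mdist x y < e) :> Prop.
Proof. by rewrite ballEmdist. Qed.

Lemma mdist_ler_add (x x' y y' : X) :
  mdist x y <= mdist x' y' + (mdist x x' + mdist y y').
Proof.
apply: le_trans (metric_triangle x x' y) _; rewrite addrCA lerD2l.
by rewrite (metric_sym y y'); exact: metric_triangle.
Qed.

Lemma continuous_mdist : continuous (fun z : X * X => mdist z.1 z.2).
Proof.
move=> /= [x y]; apply/cvgrPdist_lt => e e0.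
have e2 : 0 < e / 2 by rewrite divr_gt0.
exists (ball x (e / 2), ball y (e / 2)).
  by split; exact: nbhsx_ballx.
move=> -[x' y'] [/=]; rewrite !ball_mdist => xx' yy'.
rewrite ltr_distl; have := mdist_ler_add x x' y y'.
have := mdist_ler_add x' x y' y; rewrite (metric_sym x' x) (metric_sym y' y).
by move=> h1 h2; apply/andP; split; lra.
Qed.

Lemma lipschitz_continuous (f : X -> R) (L : R) :
  (forall x y, `|f x - f y| <= L * mdist x y) -> continuous f.
Proof.
move=> fL x; apply/cvgrPdist_lt => e e0.
have L1 : 0 < `|L| + 1 by rewrite ltr_pwDr.
near=> y; apply: le_lt_trans (fL x y) _.
have : mdist x y < e / (`|L| + 1).
  by rewrite -ball_mdist; near: y; apply: nbhsx_ballx; rewrite divr_gt0.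
rewrite ltr_pdivlMr// mulrC; apply: le_lt_trans.
by rewrite ler_wpM2r ?mdist_ge0// (le_trans (ler_norm _))// lerDl.
Unshelve. all: by end_near. Qed.

Lemma measurable_continuous (f : X -> R) : continuous f ->
  measurable_fun setT (f : borel X -> R).
Proof.
move=> cf; apply: measurable_superlevel => a; apply: open_borel.
by apply: (open_comp (f := f) (D := [set y | a < y])) => // x _; exact: cf.
Qed.

Hypothesis cX : compact [set: X].

(** The sigma-algebra on the product is generated by rectangles of Borel sets; an
    open set belongs to it because, with a countable basis, it is a countable
    union of open rectangles. *)
Lemma measurable_open_prod (O : set (X * X)) : open O ->
  measurable (O : set (borel X * borel X)%type).
Proof.
move=> oO; have [B cB [oB bB]] := compact_second_countable cX.
pose F (UV : set X * set X) : set (borel X * borel X) :=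
  if `[< [/\ B UV.1, B UV.2 & UV.1 `*` UV.2 `<=` O] >] then UV.1 `*` UV.2 else set0.
have -> : O = \bigcup_(UV in B `*` B) F UV.
  apply/seteqP; split => [[x y] Oxy|[x y] [UV _]]; last first.
    by rewrite /F; case: ifPn => // /asboolP[_ _]; exact.
  have : nbhs (x, y) O by exact: open_nbhs_nbhs.
  move=> [[U V] /= [xU yV] UVO].
  have [U' [BU' xU'] UU'] := bB x U xU.
  have [V' [BV' yV'] VV'] := bB y V yV.
  exists (U', V') => //=; rewrite /F asboolT; last first.
    by split => // -[a b] [/= U'a V'b]; apply: UVO; split; [exact: UU'|exact: VV'].
  by [].
have mF UV : measurable (F UV).
  rewrite /F; case: ifPn => // /asboolP[BU BV _].
  by apply: measurableX; apply: open_borel; exact: oB.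
have /pfcard_geP[->|[f]] : countable (B `*` B) by exact: countableX.
  by rewrite bigcup_set0.
by rewrite -(image_eq f) bigcup_image; exact: bigcup_measurable.
Qed.

Lemma measurable_mdist :
  measurable_fun setT (fun z : borel X * borel X => mdist (z.1 : X) (z.2 : X)).
Proof.
apply: measurable_superlevel => a; apply: measurable_open_prod.
apply: (open_comp (f := fun z : X * X => mdist z.1 z.2) (D := [set y | a < y])) => //.
by move=> z _; exact: continuous_mdist.
Qed.

Lemma continuous_bounded (f : X -> R) : continuous f ->
  exists2 M, 0 <= M & forall x, `|f x| <= M.
Proof.
move=> cf; have : compact (f @` setT).
  by apply: continuous_compact => //; exact: continuous_subspaceT.
move=> /compact_bounded[M [Mr MP]].
exists (`|M| + 1); first by rewrite addr_ge0.
move=> x; apply: MP; last by exists x.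
by rewrite (le_lt_trans (ler_norm _))// ltrDl.
Qed.

Lemma mdist_bounded : exists2 D, 0 < D & forall x y : X, mdist x y <= D.
Proof.
have [|M M0 MP] := continuous_bounded (fun x => mdist point x).
  apply: (lipschitz_continuous _ 1) => x y; rewrite mul1r ler_norml.
  have h1 := metric_triangle point x y; have h2 := metric_triangle point y x.
  by rewrite (metric_sym y x) in h2; apply/andP; split; lra.
exists (M + M + 1); first by rewrite ltr_wpDl// addr_ge0.
move=> x y; apply: le_trans (metric_triangle x point y) _.
have := MP x; have := MP y; rewrite !ger0_norm ?mdist_ge0// (metric_sym x).
by move=> h1 h2; lra.
Qed.

End metric_space.

(** * The descending slope at a positive scale *)

Section descent.
Context {R : realType} {X : pmetricType R}.
Variables (f : X -> R) (L : R).
Hypothesis fL : forall x y, `|f x - f y| <= L * mdist x y.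

(** The centre of the ball contributes the quotient [0 / 0 = 0], which makes the
    set nonempty and the rate nonnegative, and accounts for the value 0 of the
    slope at isolated points. *)
Definition descent_rate (n : nat) (x : X) : R :=
  sup [set Num.max (f x - f y) 0 / mdist x y | y in ball x n.+1%:R^-1].

Let quot x y := Num.max (f x - f y) 0 / mdist x y.

Let quotxx x : quot x x = 0.
Proof. by rewrite /quot subrr maxxx mul0r. Qed.

Let quot_ge0 x y : 0 <= quot x y.
Proof. by rewrite divr_ge0 ?mdist_ge0// le_max lexx orbT. Qed.

Let quot_le x y : quot x y <= `|L|.
Proof.
have [->|xy] := eqVneq x y; first by rewrite quotxx.
rewrite /quot ler_pdivrMr ?mdist_gt0// ge_max mulr_ge0 ?mdist_ge0// andbT.
rewrite (le_trans (ler_norm _))// (le_trans (fL x y))//.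
by rewrite ler_wpM2r ?mdist_ge0// ler_norm.
Qed.

Let has_sup_quot n x : has_sup [set quot x y | y in ball x n.+1%:R^-1].
Proof.
split; first by exists (quot x x), x => //; exact: ballxx.
by exists `|L| => _ [y _ <-].
Qed.

Let le_descent_rate n x y : mdist x y < n.+1%:R^-1 -> quot x y <= descent_rate n x.
Proof.
move=> xy; apply: sup_upper_bound; first exact: has_sup_quot.
by exists y => //=; rewrite ball_mdist.
Qed.

Lemma descent_rate_ge0 n x : 0 <= descent_rate n x.
Proof. by rewrite -(quotxx x) le_descent_rate// mdistxx. Qed.

Lemma descent_rate_le n x : descent_rate n x <= `|L|.
Proof.
by apply: ge_sup => [|_ [y _ <-]]; [exact: (has_sup_quot n x).1|exact: quot_le].
Qed.

Lemma descent_rateP n x y : mdist x y < n.+1%:R^-1 ->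
  f x - f y <= descent_rate n x * mdist x y.
Proof.
move=> /le_descent_rate; have [->|xy] := eqVneq x y.
  by rewrite subrr mdistxx mulr0.
rewrite /quot ler_pdivrMr ?mdist_gt0//; apply: le_trans.
by rewrite le_max lexx.
Qed.

(** The rate is lower semicontinuous: for [a >= 0], it exceeds [a] at [x] exactly
    when some [y] satisfies two inequalities that are open in [x]. *)
Lemma measurable_descent_rate n :
  measurable_fun setT (descent_rate n : borel X -> R).
Proof.
have cf : continuous f by exact: lipschitz_continuous fL.
apply: measurable_superlevel => a; apply: open_borel.
have [a0|a0] := ltP a 0.
  rewrite (_ : [set x | _] = setT); first exact: openT.
  by apply/seteqP; split => // x _ /=; rewrite (lt_le_trans a0)// descent_rate_ge0.
rewrite (_ : [set x | _] = \bigcup_y [set x | (mdist x y < n.+1%:R^-1) &&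
    (a * mdist x y < f x - f y)]).
  apply: bigcup_open => y _.
  have cd : continuous (fun x : X => mdist x y).
    move=> x; apply: (@continuous_comp _ _ _ (fun x : X => (x, y))
      (fun z : X * X => mdist z.1 z.2)).
      by apply: cvg_pair => //; exact: cvg_cst.
    exact: continuous_mdist.
  rewrite (_ : [set x | _] = [set x | mdist x y < n.+1%:R^-1] `&`
      [set x | 0 < f x - f y - a * mdist x y]); last first.
    by apply/seteqP; split => x /=; rewrite subr_gt0 => /andP.
  apply: openI.
    apply: (open_comp (f := fun x : X => mdist x y) (D := [set z | z < n.+1%:R^-1])) => //.
  apply: (open_comp (f := fun x : X => f x - f y - a * mdist x y) (D := [set z | 0 < z])) => //.
  move=> x _; apply: cvgB; last by apply: cvgM; [exact: cvg_cst|exact: cd].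
  by apply: cvgB; [exact: cf|exact: cvg_cst].
apply/seteqP; split => [x /= ax|x [y _ /= /andP[xy axy]]].
  have [_ [y xy <-]] := sup_gt (has_sup_quot n x).1 ax.
  move=> aq; exists y => //=; move: xy; rewrite /= ball_mdist => -> /=.
  have [xy0|xy0] := eqVneq x y.
    by move: aq; rewrite xy0 quotxx ltNge a0.
  move: aq; rewrite /quot ltr_pdivlMr ?mdist_gt0// lt_max => /orP[//|].
  by rewrite ltNge mulr_ge0// mdist_ge0.
apply: lt_le_trans (le_descent_rate _ _ _ xy).
have xy0 : x != y.
  by apply: contraTneq axy => ->; rewrite mdistxx mulr0 subrr ltxx.
by rewrite /quot ltr_pdivlMr ?mdist_gt0// lt_max axy.
Qed.

Lemma nonincreasing_descent_rate x : nonincreasing_seq (descent_rate ^~ x).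
Proof.
move=> m n mn; apply: ge_sup; first exact: (has_sup_quot n x).1.
move=> _ [y + <-]; rewrite ball_mdist => xy; apply: le_descent_rate.
by rewrite (lt_le_trans xy)// lef_pV2 ?posrE// ler_nat.
Qed.

Lemma is_cvg_descent_rate x : cvgn (descent_rate ^~ x).
Proof.
apply: nonincreasing_is_cvgn; first exact: nonincreasing_descent_rate.
by exists 0 => _ [n _ <-]; exact: descent_rate_ge0.
Qed.

(** At a non-isolated point every punctured neighbourhood [V] contains a point of
    the punctured ball, so the supremum over [V] is nonnegative and adding the
    centre does not increase it. *)
Lemma lim_descent_rate_le_slope x :
  ((limn (descent_rate ^~ x))%:E <= desc_slope f x)%E.
Proof.
have le_lim n : limn (descent_rate ^~ x) <= descent_rate n x.
  apply: nonincreasing_cvgn_ge; first exact: nonincreasing_descent_rate.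
  exact: is_cvg_descent_rate.
have nbhs_n (V : set X) : nbhs x V -> exists n, ball x n.+1%:R^-1 `<=` V.
  move=> /nbhs_ballP[e /= e0 eV].
  have [n] := ltr_add_invr e0; rewrite add0r => ne.
  by exists n; apply: subset_trans eV; apply: le_ball; exact: ltW.
rewrite /desc_slope; case: ifPn => [/asboolP[_ [V /nbhs_n[n nV] Vx]]|/asboolP iso].
  rewrite lee_fin (le_trans (le_lim n))//.
  apply: ge_sup => [|_ [y /nV Vy <-]]; first exact: (has_sup_quot n x).1.
  have : [set x] y by rewrite -Vx.
  by move=> ->; rewrite -/(quot x x) quotxx.
rewrite limf_esupE; apply: le_ereal_inf_tmp => _ [V xV <-].
have /nbhs_n[n nV] : nbhs x [set y | y != x -> V y] by exact: xV.
have Vq y : V y -> ((quot x y)%:E <= ereal_sup [set (quot x y)%:E | y in V])%E.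
  by move=> Vy; apply: ereal_sup_ubound; exists y.
have [y [Vy yx]] : exists y, V y /\ ball x n.+1%:R^-1 y.
  apply: contrapT => /forallNP h; apply: iso; split; first by rewrite inE.
  exists (ball x n.+1%:R^-1); first exact: nbhsx_ballx.
  rewrite setIT; apply/seteqP; split => [y xy|_ ->]; last exact: ballxx.
  by apply: contrapT => /eqP yx; apply: (h y); split => //; exact: nV xy yx.
have sup0 : (0 <= ereal_sup [set (quot x y)%:E | y in V])%E.
  by apply: le_trans (Vq y Vy); rewrite lee_fin.
apply: (@le_trans _ _ (descent_rate n x)%:E); first by rewrite lee_fin.
move: sup0 Vq; rewrite -/(quot x); set s := ereal_sup _.
case: s => [s| |]; [|by move=> _ _; rewrite leey|by []].
rewrite !lee_fin => s0 Vs.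
apply: ge_sup => [|_ [z /nV Vz <-]]; first exact: (has_sup_quot n x).1.
have [->|zx] := eqVneq z x; first by rewrite -/(quot x x) quotxx.
by have := Vs z (Vz zx); rewrite lee_fin.
Qed.

Lemma lim_descent_rate_ge0 x : 0 <= limn (descent_rate ^~ x).
Proof.
apply: limr_ge; first exact: is_cvg_descent_rate.
by apply: nearW => n; exact: descent_rate_ge0.
Qed.

Lemma descent_rate_min n x : (forall y, f x <= f y) -> descent_rate n x = 0.
Proof.
move=> fx; apply/eqP; rewrite eq_le descent_rate_ge0 andbT.
apply: ge_sup => [|_ [y _ <-]]; first exact: (has_sup_quot n x).1.
by rewrite max_r ?mul0r// subr_le0.
Qed.

End descent.

(** * The curvature inequality along a transport to the reference measure *)

Section integral_monotone.
Local Open Scope ereal_scope.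
Context d (T : measurableType d) (R : realType) (m : {measure set T -> \bar R}).
Implicit Types f g : T -> \bar R.

(** The integral of a nonnegative function is a supremum over the simple
    functions below it, so it is monotone on arbitrary functions, among them
    integrands built from [betaU] or from the descending slope. *)
Lemma ge0_integral_mono f g : (forall x, 0 <= f x) ->
  (forall x, f x <= g x) -> \int[m]_x f x <= \int[m]_x g x.
Proof.
move=> f0 fg; rewrite !ge0_integralTE//; last first.
  by move=> x; exact: le_trans (f0 x) (fg x).
apply: ereal_sup_le => _ [h /= hf <-]; exists h => //= x.
exact: le_trans (hf x) (fg x).
Qed.

Lemma le0_integral_mono f g : (forall x, g x <= 0) ->
  (forall x, f x <= g x) -> \int[m]_x f x <= \int[m]_x g x.
Proof.
move=> g0 fg.
have E h : (forall x, h x <= 0) -> \int[m]_x h x = - \int[m]_x (- h x).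
  move=> h0; rewrite -integral_ge0N; last by move=> x _; rewrite oppe_ge0.
  by apply: eq_integral => x _; rewrite oppeK.
rewrite (E g)// (E f); last by move=> x; exact: le_trans (fg x) (g0 x).
rewrite leeN2; apply: ge0_integral_mono => x; first by rewrite oppe_ge0.
by rewrite leeN2.
Qed.

End integral_monotone.

Section disintegration_snd.
Local Open Scope ereal_scope.
Context {R : realType} {X : pmetricType R}.

Lemma ge0_integral_disintegration_snd (mu1 : probability (borel X) R)
  (p : probability (borel X * borel X)%type R) (k1 : R.-pker borel X ~> borel X)
  (f : borel X * borel X -> \bar R) :
  disintegration_snd mu1 p k1 -> (forall z, 0 <= f z) -> measurable_fun setT f ->
  \int[p]_z f z = \int[mu1]_x1 \int[k1 x1]_x0 f (x0, x1).
Proof.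
move=> pE f0 mf.
have msw : measurable_fun setT (fun z : borel X * borel X => (z.2, z.1)).
  by apply: measurable_fun_pair.
have := @ge0_integral_disintegration _ _ _ _ R mu1 k1
  (pushforward p (fun z : borel X * borel X => (z.2, z.1)))
  (fun z => f (z.2, z.1)).
move=> <-//; last 2 first.
- move=> C mC.
  rewrite [LHS]pE; last by rewrite -[X in measurable X]setTI; exact: msw.
  apply: eq_integral => x1 _; by congr (k1 x1 _).
- exact: measurableT_comp.
rewrite ge0_integral_pushforward//; last exact: measurableT_comp.
by apply: eq_integral => -[].
Qed.

End disintegration_snd.

Section lebesgue_decompositions.
Local Open Scope ereal_scope.
Context d (T : measurableType d) (R : realType).
Implicit Types nu mu : {measure set T -> \bar R}.

Lemma lebesgue_decomposition_density nu mu (rho : T -> R) :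
  measurable_fun setT rho -> (forall x, (0 <= rho x)%R) ->
  (forall A, measurable A -> mu A = \int[nu]_(x in A) (rho x)%:E) ->
  lebesgue_decomposition nu mu rho mzero.
Proof.
move=> mrho rho0 muE; split => //; first by exists set0; split.
by move=> A mA; rewrite muE// /mzero adde0.
Qed.

(** The absolutely continuous part of a measure is below the measure. *)
Lemma le_integral_lebesgue_decomposition nu mu rho mus (f : T -> \bar R) :
  lebesgue_decomposition nu mu rho mus ->
  (forall x, 0 <= f x) -> measurable_fun setT f ->
  \int[nu]_x ((rho x)%:E * f x) <= \int[mu]_x f x.
Proof.
move=> [mrho rho0 _ muE] f0 mf.
have [m mE] := exists_density_measure _ _ _ nu rho mrho rho0.
rewrite -(ge0_integral_density _ _ _ nu rho mrho rho0 m)//.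
rewrite (@eq_measure_integral _ _ _ setT (measure_add m mus) mu).
  by rewrite ge0_integral_measure_add// leeDl// integral_ge0.
by move=> A mA _; rewrite muE// -mE; exact: (esym (measure_addE m mus A)).
Qed.

(** The convex energy of [mu] lies above its tangent functional at the density
    [a]; both sides appear here with the opposite sign. *)
Lemma tsallis_tangent_integral (N : R) nu mu rho mus (a : T -> R) :
  (1 < N)%R -> lebesgue_decomposition nu mu rho mus ->
  (forall x, (0 < a x)%R) -> measurable_fun setT a ->
  \int[nu]_x (rho x `^ (1 - N^-1))%:E <=
  (N^-1)%:E * \int[nu]_x (a x `^ (1 - N^-1))%:E +
  (1 - N^-1)%:E * \int[mu]_x (a x `^ (- N^-1))%:E.
Proof.
move=> N1 dec a0 ma; have [mrho rho0 _ _] := dec.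
have N0 : (0 < N)%R by exact: lt_trans N1.
have s0 : (0 < 1 - N^-1)%R by rewrite subr_gt0 invf_lt1.
have mpow p : measurable_fun setT (fun x => (a x `^ p)%:E).
  by apply/measurable_EFinP; exact: measurableT_comp (measurable_powR _) _.
have F0 x : 0 <= (a x `^ (- N^-1))%:E by rewrite lee_fin powR_ge0.
apply: le_trans (leeD2l _ (lee_wpmul2l _
  (le_integral_lebesgue_decomposition nu mu rho mus _ dec F0 (mpow _)))); last first.
  by rewrite lee_fin ltW.
rewrite -ge0_integralZl_EFin//; last 2 first.
- by move=> x _; rewrite lee_fin powR_ge0.
- by rewrite invr_ge0 ltW.
have mrf : measurable_fun setT (fun x => (rho x)%:E * (a x `^ (- N^-1))%:E).
  by apply: emeasurable_funM => //; exact/measurable_EFinP.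
rewrite -ge0_integralZl_EFin//; last 2 first.
- by move=> x _; rewrite mule_ge0// lee_fin.
- exact: ltW.
have h1 x : setT x -> 0 <= (N^-1)%:E * (a x `^ (1 - N^-1))%:E.
  by rewrite mule_ge0// lee_fin ?invr_ge0 ?powR_ge0// ltW.
have h2 x : setT x -> 0 <= (1 - N^-1)%:E * ((rho x)%:E * (a x `^ (- N^-1))%:E).
  by move=> _; apply: mule_ge0; [rewrite lee_fin ltW|apply: mule_ge0; rewrite ?F0 ?lee_fin].
have m1 := measurable_funeM (N^-1)%:E (mpow (1 - N^-1)%R).
have m2 := measurable_funeM (1 - N^-1)%:E mrf.
rewrite -ge0_integralD//.
apply: ge0_integral_mono => x; first by rewrite lee_fin powR_ge0.
rewrite -!EFinM -EFinD lee_fin.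
have s01 : (0 <= 1 - N^-1 <= 1)%R by rewrite ltW//= gerBl invr_ge0 ltW.
have := powR_le_tangent _ (1 - N^-1) (a x) (rho x) s01 (a0 x) (rho0 x).
have -> : (1 - (1 - N^-1) = N^-1)%R by ring.
have -> : (1 - N^-1 - 1 = - N^-1)%R by ring.
by rewrite (mulrC (rho x)).
Qed.

End lebesgue_decompositions.

Section transport_inequality.
Local Open Scope ereal_scope.
Context {R : realType} {X : pmetricType R}.
Variables (nu : probability (borel X) R) (N K : R).
Hypotheses (N1 : (1 < N)%R) (K0 : (0 < K)%R) (cX : compact [set: X]).

Let N0 : (0 < N)%R. Proof. exact: lt_trans N1. Qed.
Let s0 : (0 < 1 - N^-1)%R. Proof. by rewrite subr_gt0 invf_lt1. Qed.

Lemma msupport_density (mu : probability (borel X) R) (rho : borel X -> R) :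
  (forall A, measurable A -> mu A = \int[nu]_(x in A) (rho x)%:E) ->
  measurable_fun setT rho -> msupport mu `<=` msupport nu.
Proof.
move=> muE mrho x mux U [oU xU]; have := mux U (conj oU xU).
have mU := open_borel U oU.
rewrite muE// lt0e => /andP[+ _]; rewrite lt0e measure_ge0 andbT.
apply: contra => /eqP nuU; apply/eqP; apply: null_set_integral => //.
by apply/measurable_EFinP; exact: measurable_funTS.
Qed.

(** The lower bound for [beta^(1/N)], with the angle [sqrt(K / (N - 1)) * d]
    substituted in it. *)
Definition distortion_weight (t : R) (x0 x1 : X) : R :=
  (1 + (1 - t ^+ 2) * (K / (6 * N)) * mdist x0 x1 ^+ 2)%R.

Lemma betaU_beta_le (t r : R) (x0 x1 : X) : (0 < t < 1)%R -> (0 <= r)%R ->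
  betaU (tsallis N) (beta N K t x0 x1) r <=
  (- (r `^ (1 - N^-1) * distortion_weight t x0 x1))%:E.
Proof.
move=> t01 r0.
have KN : (0 <= K / (N - 1))%R by rewrite divr_ge0 ?subr_ge0 ?ltW.
have := betaU_tsallis_le N N1 t (Num.sqrt (K / (N - 1)) * mdist x0 x1) r t01 _ r0.
rewrite mulr_ge0 ?sqrtr_ge0 ?mdist_ge0// => /(_ isT) /le_trans; apply.
rewrite lee_fin lerN2 exprMn sqr_sqrtr//.
rewrite le_eqVlt; apply/orP; left; apply/eqP; congr (_ * _)%R.
rewrite /distortion_weight; field.
by rewrite subr_eq0 !gt_eqF.
Qed.

Lemma distortion_weight_ge0 t x0 x1 : (0 < t < 1)%R ->
  (0 <= distortion_weight t x0 x1)%R.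
Proof.
move=> /andP[t0 t1]; rewrite /distortion_weight addr_ge0//.
have t2 : (0 <= 1 - t ^+ 2)%R by rewrite subr_ge0 expr_le1// ltW.
have kn : (0 <= K / (6 * N))%R by rewrite divr_ge0 ?mulr_ge0 ?(ltW K0) ?(ltW N0).
by rewrite mulr_ge0 ?sqr_ge0// mulr_ge0.
Qed.

Lemma measurable_distortion_weight t : measurable_fun setT
  (fun z : borel X * borel X => distortion_weight t z.1 z.2).
Proof.
apply: measurable_funD => //; apply: measurable_funM => //.
by apply: measurable_funX; exact: measurable_mdist cX.
Qed.

Lemma distorted_energy_le (mu : probability (borel X) R)
    (k : R.-pker borel X ~> borel X) (b : X -> X -> \bar R) (w : X -> X -> R)
    (rho : X -> R) :
  (forall x y, (0 <= rho x `^ (1 - N^-1) * w x y)%R) ->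
  (forall x y, betaU (tsallis N) (b x y) (rho x) <=
     (- (rho x `^ (1 - N^-1) * w x y))%:E) ->
  \int[mu]_x \int[k x]_y betaU (tsallis N) (b x y) (rho x) <=
  - \int[mu]_x \int[k x]_y (rho x `^ (1 - N^-1) * w x y)%:E.
Proof.
move=> w0 bw.
have ge0 x : 0 <= \int[k x]_y (rho x `^ (1 - N^-1) * w x y)%:E.
  by apply: integral_ge0 => y _; rewrite lee_fin.
rewrite -integral_ge0N; last by move=> x _; exact: ge0.
apply: le0_integral_mono => x; first by rewrite oppe_le0.
rewrite -integral_ge0N; last by move=> y _; rewrite lee_fin.
apply: le0_integral_mono => y; first by rewrite oppe_le0 lee_fin.
exact: bw.
Qed.

End transport_inequality.

(** Reversing the signs is legitimate although [e0] and [e1] may be [-oo]: no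
    indeterminate sum arises, all the terms being of the same sign. *)
Lemma le_of_oppe_le_combination (R : realType) (a b : R) (e0 e1 x0 x1 y : \bar R) :
  (0 <= a)%R -> (0 <= b)%R -> (0 <= x0 -> 0 <= x1 ->
  e0 <= - x0 -> e1 <= - x1 -> - y <= a%:E * e0 + b%:E * e1 ->
  a%:E * x0 + b%:E * x1 <= y)%E.
Proof.
move=> a0 b0 x00 x10 e0x e1x yle; rewrite -leeN2 oppeD; last first.
  by apply: ge0_adde_def; rewrite inE mule_ge0// lee_fin.
rewrite -!muleN; apply: le_trans yle _.
by apply: leeD; apply: lee_wpmul2l.
Qed.

Section transport_inequality.
Local Open Scope ereal_scope.
Context {R : realType} {X : pmetricType R}.
Variables (nu : probability (borel X) R) (N K : R).
Hypotheses (N1 : (1 < N)%R) (K0 : (0 < K)%R) (cX : compact [set: X]).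

Let N0 : (0 < N)%R. Proof. exact: lt_trans N1. Qed.
Let s0 : (0 < 1 - N^-1)%R. Proof. by rewrite subr_gt0 invf_lt1. Qed.

(** The plan is chosen before the time, so the same [P] serves for all [t]; this
    is what allows [t] to tend to 0 afterwards. *)
Lemma displacement_inequality (rho : X -> R) :
  Ricci_bounded_below nu N K ->
  (forall x, (0 < rho x)%R) -> continuous rho -> \int[nu]_x (rho x)%:E = 1 ->
  exists P : probability (borel (geodesic X)) R,
    (forall h : borel X -> \bar R, (forall x, 0 <= h x) -> measurable_fun setT h ->
       \int[P]_g h (eval_at (0%:i01)%R g) = \int[nu]_x ((rho x)%:E * h x)) /\
    (forall t : {i01 R}, (0 < t%:num < 1)%R ->
       (1 - t%:num)%:E * \int[P]_g (rho (eval_at (0%:i01)%R g) `^ (- N^-1) *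
          distortion_weight N K (1 - t%:num)%R (eval_at (0%:i01)%R g) (eval_at (1%:i01)%R g))%:E +
       t%:num%:E * \int[P]_g
          (distortion_weight N K t%:num (eval_at (0%:i01)%R g) (eval_at (1%:i01)%R g))%:E <=
       (N^-1)%:E * \int[nu]_x (rho x `^ (1 - N^-1))%:E +
       (1 - N^-1)%:E * \int[P]_g (rho (eval_at t g) `^ (- N^-1))%:E).
Proof.
move=> Ric rho0 crho rho1.
have mrho : measurable_fun setT (rho : borel X -> R) by exact: measurable_continuous.
have rhoge0 x : (0 <= rho x)%R by exact: ltW.
have [mu0 mu0E] := exists_density_probability _ _ _ nu _ mrho rhoge0 rho1.
have m1 : measurable_fun setT (fun _ : borel X => 1%R : R) by [].
have nuE A : measurable A -> nu A = \int[nu]_(x in A) ((1 : R)%:E).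
  by move=> mA; rewrite integral_cst// mul1e.
have dec0 : lebesgue_decomposition nu mu0 rho mzero.
  by apply: lebesgue_decomposition_density => // A _; exact: mu0E.
have dec1 : lebesgue_decomposition nu nu (fun=> 1%R) mzero.
  by apply: lebesgue_decomposition_density.
have supp0 : msupport mu0 `<=` msupport nu.
  by apply: (msupport_density _ _ rho) => // A _; exact: mu0E.
have [P [k0 [k1 [opt dis0 dis1 HU]]]] :=
  Ric mu0 nu rho (fun=> 1%R) mzero mzero supp0 (@subset_refl _ _) dec0 dec1.
exists P.
have h0E (h : borel X -> \bar R) : (forall x, 0 <= h x) -> measurable_fun setT h ->
    \int[P]_g h (eval_at (0%:i01)%R g) = \int[nu]_x ((rho x)%:E * h x).
  move=> h0 mh.
  rewrite -(ge0_integral_density _ _ _ nu rho mrho rhoge0 mu0 h)//; last first.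
    by move=> A _; exact: mu0E.
  rewrite -(@ge0_integral_distribution _ _ _ _ _ P (@eval_at R X (0%:i01)%R))//.
  apply: eq_measure_integral => A mA _.
  have [h1 _] := opt.1 A mA; apply: etrans h1.
  rewrite /distribution /pushforward/=; congr (P _).
  by apply/seteqP; split => g //= -[].
split=> // t t01.
have ct01 : (0 < 1 - t%:num < 1)%R.
  by move/andP: t01 => [t0 t1]; rewrite subr_gt0 t1 gtrBl.
have [rhot [muts [dect Hle]]] := HU (tsallis N) t (DC_tsallis N N1).
move: Hle; rewrite /Ufunctional Uprime_oo_tsallis// !mul0e !adde0 => Hle.
have mrhop p : measurable_fun setT (fun x : borel X => (rho x `^ p)%:E).
  by apply/measurable_EFinP; exact: measurableT_comp (measurable_powR _) _.
have up := tsallis_tangent_integral _ _ _ N nu _ rhot muts rho N1 dect rho0 mrho.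
rewrite (@ge0_integral_distribution _ _ _ _ _ P (@eval_at R X t)) in up; last 2 first.
  exact: mrhop.
  by move=> x; rewrite lee_fin powR_ge0.
apply: le_trans up.
pose w0 := distortion_weight (X := X) N K (1 - t%:num)%R.
pose w1 := distortion_weight (X := X) N K t%:num.
have w0_ge0 x y : (0 <= w0 x y)%R by exact: distortion_weight_ge0.
have w1_ge0 x y : (0 <= w1 x y)%R by exact: distortion_weight_ge0.
have mw u : measurable_fun setT (fun z : borel X * borel X =>
    distortion_weight N K u z.1 z.2).
  exact: measurable_distortion_weight.
have B0 : \int[nu]_x \int[k0 x]_y (rho x `^ (1 - N^-1) * w0 x y)%:E =
    \int[P]_g (rho (eval_at (0%:i01)%R g) `^ (- N^-1) *
          w0 (eval_at (0%:i01)%R g) (eval_at (1%:i01)%R g))%:E.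
  pose f (z : borel X * borel X) : \bar R := (rho z.1 `^ (- N^-1) * w0 z.1 z.2)%:E.
  have f0 z : 0 <= f z by rewrite lee_fin mulr_ge0// powR_ge0.
  have mf : measurable_fun setT f.
    apply/measurable_EFinP; apply: measurable_funM; last exact: mw.
    apply: (measurableT_comp (measurable_powR _)).
    exact: (measurableT_comp mrho).
  transitivity (\int[distribution P (@endpoints R X)]_z f z); last first.
    by rewrite ge0_integral_distribution.
  rewrite (ge0_integral_disintegration _ _ _ _ _ mu0 k0)//.
  rewrite (ge0_integral_density _ _ _ nu rho)//; last 3 first.
    by move=> A _; exact: mu0E.
    by move=> x; exact: integral_ge0.
    exact: measurable_integral_pker.
  apply: eq_integral => x _; rewrite -ge0_integralZl_EFin//; last first.
    by apply: measurableT_comp.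
  apply: eq_integral => y _; rewrite /f/= -EFinM mulrA; congr (_ * _)%:E.
  by rewrite powRD ?(gt_eqF (rho0 x)) ?implybT// powRr1.
have B1 : \int[nu]_y \int[k1 y]_x ((1 : R) `^ (1 - N^-1) * w1 x y)%:E =
    \int[P]_g (w1 (eval_at (0%:i01)%R g) (eval_at (1%:i01)%R g))%:E.
  pose f (z : borel X * borel X) : \bar R := (w1 z.1 z.2)%:E.
  have f0 z : 0 <= f z by rewrite lee_fin.
  have mf : measurable_fun setT f by apply/measurable_EFinP; exact: mw.
  transitivity (\int[distribution P (@endpoints R X)]_z f z); last first.
    by rewrite ge0_integral_distribution.
  rewrite (ge0_integral_disintegration_snd nu _ k1)//.
  apply: eq_integral => y _; apply: eq_integral => x _.
  by rewrite powR1 mul1r.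
have le0 : \int[nu]_x \int[k0 x]_y
    betaU (tsallis N) (beta N K (1 - t%:num)%R x y) (rho x) <=
    - \int[nu]_x \int[k0 x]_y (rho x `^ (1 - N^-1) * w0 x y)%:E.
  apply: distorted_energy_le => x y; first by rewrite mulr_ge0// powR_ge0.
  exact: betaU_beta_le.
have le1 : \int[nu]_y \int[k1 y]_x
    betaU (tsallis N) (beta N K t%:num x y) 1%R <=
    - \int[nu]_y \int[k1 y]_x ((1 : R) `^ (1 - N^-1) * w1 x y)%:E.
  apply: (distorted_energy_le N nu k1 (fun y x => beta N K t%:num x y)
    (fun y x => w1 x y) (fun=> 1%R)) => y x; first by rewrite mulr_ge0// powR_ge0.
  exact: betaU_beta_le.
rewrite -B0 -B1; apply: (le_of_oppe_le_combination _ _ _ _ _ _ _ _ _ _ _ _ le0 le1).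
- by case/andP: ct01 => /ltW.
- by case/andP: t01 => /ltW.
- apply: integral_ge0 => x _; apply: integral_ge0 => y _.
  by rewrite lee_fin mulr_ge0// powR_ge0.
- apply: integral_ge0 => x _; apply: integral_ge0 => y _.
  by rewrite lee_fin mulr_ge0// powR_ge0.
- by rewrite -integral_ge0N// => x _; rewrite lee_fin powR_ge0.
Qed.

End transport_inequality.

(** * First variation of the energy along geodesics *)

Lemma young_weighted (R : realType) (k w a d : R) : 0 < k -> 0 < w ->
  a * d <= a ^+ 2 / (2 * k * w) + k / 2 * w * d ^+ 2.
Proof.
move=> k0 w0.
have kw0 : 0 < 2 * k * w by rewrite !mulr_gt0.
rewrite -subr_ge0.
have -> : a ^+ 2 / (2 * k * w) + k / 2 * w * d ^+ 2 - a * d =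
    (a - k * w * d) ^+ 2 / (2 * k * w).
  by field; rewrite !gt_eqF.
by rewrite divr_ge0 ?sqr_ge0 ?ltW.
Qed.

(** The weight of the squared distance in the first order term of the
    curvature inequality: 1/3 comes from the coefficient [beta_t] of the final
    measure and [2/3 * r^(-1/N)] from [beta_(1-t)] of the initial one. *)
Definition weight {R : realType} (N r : R) : R := 3^-1 + 2 / 3 * r `^ (- N^-1).

(** Multiplied by the density [r], this is the integrand of the right-hand side
    of the main theorem, for a slope [g]. *)
Definition fisher_density {R : realType} (N r g : R) : R :=
  (r `^ (- N^-1) / r) ^+ 2 / weight N r * g ^+ 2.

Lemma weight_ge {R : realType} (N r : R) : 3^-1 <= weight N r.
Proof. by rewrite /weight lerDl mulr_ge0 ?powR_ge0. Qed.

Lemma weight_gt0 {R : realType} (N r : R) : 0 < weight N r.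
Proof. by apply: lt_le_trans (weight_ge N r). Qed.

Lemma measurable_weightV d (T : measurableType d) (R : realType) (N : R) (f : T -> R) :
  measurable_fun setT f -> measurable_fun setT (fun x => (weight N (f x))^-1).
Proof.
move=> mf; rewrite (_ : (fun x => _) = (fun x => weight N (f x) `^ (-1))).
  apply: (measurableT_comp (measurable_powR _)).
  apply: measurable_funD => //; apply: measurable_funM => //.
  exact: measurableT_comp (measurable_powR _) _.
by apply/funext => x; rewrite powR_inv1// ltW// weight_gt0.
Qed.

(** By Bernoulli's inequality,
    [ry^(-1/N) - rx^(-1/N) <= rx^(-1/N) / N * (rx - ry) / ry]; the factor [u]
    is the price of replacing [ry] by [rx] in the denominator, and Young's
    inequality separates the slope [g] from the distance [d]. *)
Lemma pressure_increment (R : realType) (N K rx ry g t d u : R) :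
  1 < N -> 0 < K -> 0 < rx -> 0 < ry -> 0 <= g -> 0 <= t -> 0 <= d ->
  rx - ry <= g * (t * d) -> rx <= u * ry ->
  (N - 1) * ry `^ (- N^-1) <= (N - 1) * rx `^ (- N^-1) +
    t * (u ^+ 2 * ((2 * K)^-1 * (1 - N^-1) ^+ 2) * fisher_density N rx g +
         K / 2 * weight N rx * d ^+ 2).
Proof.
move=> N1 K0 rx0 ry0 g0 t0 d0 slope ru.
have N0 : 0 < N by exact: lt_trans N1.
have s0 : 0 <= 1 - N^-1 by rewrite subr_ge0 invf_le1// ltW.
set Fx := rx `^ (- N^-1); set Fy := ry `^ (- N^-1).
have Fx0 : 0 < Fx by exact: powR_gt0.
have u0 : 0 <= u by rewrite -(pmulr_lge0 _ ry0) (le_trans _ ru)// ltW.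
have FyE : Fy = Fx * (rx / ry) `^ N^-1.
  rewrite powRM ?invr_ge0 ?(ltW rx0) ?(ltW ry0)// mulrA -powRD ?(gt_eqF rx0) ?implybT//.
  by rewrite addNr powRr0 mul1r -powR_inv1 ?(ltW ry0)// -powRrM mulN1r.
have iN : 0 <= N^-1 <= 1 by rewrite invr_ge0 (ltW N0)/= invf_le1// ltW.
have ratio : rx / ry - 1 <= u * g * (t * d) / rx.
  have -> : rx / ry - 1 = (rx - ry) / ry by field; rewrite gt_eqF.
  apply: (@le_trans _ _ (g * (t * d) / ry)); first by rewrite ler_pM2r ?invr_gt0.
  rewrite ler_pdivrMr// mulrAC ler_pdivlMr//.
  have : g * (t * d) * rx <= g * (t * d) * (u * ry) by rewrite ler_wpM2l// !mulr_ge0.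
  by move=> /le_trans; apply; rewrite le_eqVlt; apply/orP; left; apply/eqP; ring.
have inc : Fy - Fx <= Fx * (N^-1 * (u * g * (t * d) / rx)).
  have := powR_le_affine _ N^-1 (rx / ry) iN (divr_ge0 (ltW rx0) (ltW ry0)).
  rewrite -(ler_pM2l Fx0) -FyE => h.
  have : Fx * (N^-1 * (rx / ry - 1)) <= Fx * (N^-1 * (u * g * (t * d) / rx)).
    by rewrite ler_pM2l// ler_pM2l// invr_gt0.
  by move: h; lra.
have w0 := weight_gt0 N rx.
have young := young_weighted _ K (weight N rx) ((1 - N^-1) * u * Fx * g / rx) d K0 w0.
have step : (N - 1) * (Fy - Fx) <= t * ((1 - N^-1) * u * Fx * g / rx * d).
  have N10 : 0 <= N - 1 by rewrite subr_ge0 ltW.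
  apply: le_trans (ler_wpM2l N10 inc) _.
  rewrite le_eqVlt; apply/orP; left; apply/eqP; field.
  by rewrite !gt_eqF.
have := ler_wpM2l t0 young.
have -> : ((1 - N^-1) * u * Fx * g / rx) ^+ 2 / (2 * K * weight N rx) =
   u ^+ 2 * ((2 * K)^-1 * (1 - N^-1) ^+ 2) * fisher_density N rx g.
  by rewrite /fisher_density -/Fx; field; rewrite !gt_eqF.
by move: step; lra.
Qed.

(** * Integration over the optimal dynamical plan *)

Section bounded_measurable.
Context d (T : measurableType d) (R : realType).
Implicit Types (f g : T -> R) (P : probability T R).

Definition bounded_measurable f : Prop :=
  measurable_fun setT f /\ exists M, forall x, `|f x| <= M.

Lemma bounded_measurable_cst (r : R) : bounded_measurable (fun=> r).
Proof. by split=> //; exists `|r|. Qed.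

Lemma bounded_measurableD f g : bounded_measurable f -> bounded_measurable g ->
  bounded_measurable (fun x => f x + g x).
Proof.
move=> [mf [M fM]] [mg [M' gM']]; split; first exact: measurable_funD.
by exists (M + M') => x; rewrite (le_trans (ler_normD _ _))// lerD.
Qed.

Lemma bounded_measurableM f g : bounded_measurable f -> bounded_measurable g ->
  bounded_measurable (fun x => f x * g x).
Proof.
move=> [mf [M fM]] [mg [M' gM']]; split; first exact: measurable_funM.
by exists (M * M') => x; rewrite normrM ler_pM.
Qed.

Lemma bounded_measurable_integrable P f : bounded_measurable f ->
  P.-integrable setT (EFin \o f).
Proof.
move=> [mf [M fM]]; apply: measurable_bounded_integrable => //.
  by apply: (@le_lt_trans _ _ 1%E); [exact: probability_le1|rewrite ltry].
exists M; split; first by rewrite num_real.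
by move=> y My x _ /=; rewrite (le_trans (fM x))// ltW.
Qed.

Lemma EFin_Rintegral P f : bounded_measurable f ->
  (\int[P]_x (f x)%:E)%E = (\int[P]_x f x)%:E.
Proof.
move=> bf; rewrite fineK//; apply: integrable_fin_num => //.
exact: bounded_measurable_integrable.
Qed.

Lemma bounded_RintegralD P f g : bounded_measurable f -> bounded_measurable g ->
  \int[P]_x (f x + g x) = \int[P]_x f x + \int[P]_x g x.
Proof.
by move=> bf bg; apply: RintegralD => //; exact: bounded_measurable_integrable.
Qed.

Lemma bounded_RintegralZl P f (r : R) : bounded_measurable f ->
  \int[P]_x (r * f x) = r * \int[P]_x f x.
Proof.
by move=> bf; apply: RintegralZl => //; exact: bounded_measurable_integrable.
Qed.

Lemma bounded_le_Rintegral P f g : bounded_measurable f -> bounded_measurable g ->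
  (forall x, f x <= g x) -> \int[P]_x f x <= \int[P]_x g x.
Proof.
by move=> bf bg fg; apply: le_Rintegral => //; exact: bounded_measurable_integrable.
Qed.

Lemma Rintegral_probability_cst P (r : R) : \int[P]_x r = r.
Proof.
rewrite Rintegral_cst// -[RHS]mulr1; congr (_ * _).
by rewrite -[RHS]/(fine 1%E); congr fine; exact: probability_setT.
Qed.

End bounded_measurable.

Lemma bounded_measurable_comp d d' (T : measurableType d) (T' : measurableType d')
    (R : realType) (f : T' -> R) (h : T -> T') :
  bounded_measurable _ _ R f -> measurable_fun setT h ->
  bounded_measurable _ _ R (fun x => f (h x)).
Proof.
move=> [mf [M fM]] mh; split; first exact: measurableT_comp.
by exists M => x; exact: fM.
Qed.

Section geodesics.
Context {R : realType} {X : pmetricType R}.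

Definition gstart (z : borel (geodesic X)) : borel X := eval_at 0%:i01 z.

Definition gend (z : borel (geodesic X)) : borel X := eval_at 1%:i01 z.

Lemma mdist_eval_at (g : borel (geodesic X)) (s t : {i01 R}) :
  mdist (eval_at s g : X) (eval_at t g) = `|s%:num - t%:num| *
    mdist (eval_at (0%:i01)%R g : X) (eval_at (1%:i01)%R g).
Proof. exact: (set_valP (g : geodesic X)). Qed.

End geodesics.

Section dissipation.
Context {R : realType} {X : pmetricType R}.
Variables (nu : probability (borel X) R) (N K : R).
Hypotheses (N1 : 1 < N) (K0 : 0 < K) (cX : compact [set: X]).
Variables (rho : X -> R) (c : R).
Hypotheses (c0 : 0 < c) (rhoc : forall x, c <= rho x) (crho : continuous rho).

Let N0 : 0 < N. Proof. exact: lt_trans N1. Qed.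
Let rho0 x : 0 < rho x. Proof. exact: lt_le_trans (rhoc x). Qed.

Lemma bounded_measurable_powR (p : R) :
  bounded_measurable _ (borel X) R (fun x => rho x `^ p).
Proof.
have mrho : measurable_fun setT (rho : borel X -> R) by exact: measurable_continuous.
split; first exact: measurableT_comp (measurable_powR _) _.
have [M M0 MP] := continuous_bounded cX rho crho.
exists (expR (`|p| * (`|ln c| + `|ln M|))) => x.
rewrite ger0_norm ?powR_ge0// /powR gt_eqF// ler_expR.
apply: le_trans (ler_norm _) _; rewrite normrM ler_wpM2l//.
have cx : ln c <= ln (rho x) by rewrite ler_ln ?posrE.
have xM : rho x <= M by rewrite (le_trans (ler_norm _)).
have M1 : 0 < M by exact: lt_le_trans xM.
have xlM : ln (rho x) <= ln M by rewrite ler_ln ?posrE.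
have := ler_norm (ln M); have := ler_normlW (lexx `|ln c|).
have := ler_norm (- ln c); rewrite normrN => h1 h2 h3.
have := normr_ge0 (ln c); have := normr_ge0 (ln M) => h4 h5.
by rewrite ler_norml; apply/andP; split; lra.
Qed.

Lemma bounded_measurable_fisher (g : X -> R) :
  bounded_measurable _ (borel X) R g ->
  bounded_measurable _ (borel X) R (fun x => fisher_density N (rho x) (g x)).
Proof.
move=> bg.
have bF := bounded_measurable_powR (- N^-1).
have bq : bounded_measurable _ (borel X) R (fun x => rho x `^ (- N^-1) / rho x).
  have := bounded_measurableM _ _ _ _ _ bF (bounded_measurable_powR (-1)).
  by under eq_fun do rewrite powR_inv1 ?ltW//.
have bw : bounded_measurable _ (borel X) R (fun x => (weight N (rho x))^-1).
  split; first by apply: measurable_weightV; exact: measurable_continuous.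
  exists 3 => x; rewrite ger0_norm ?invr_ge0 ?(ltW (weight_gt0 _ _))//.
  by rewrite -[leRHS]invrK lef_pV2 ?posrE ?weight_gt0// weight_ge.
have b2 := bounded_measurableM _ _ _ _ _ bq bq.
have g2 := bounded_measurableM _ _ _ _ _ bg bg.
exact: bounded_measurableM _ _ _ _ _ (bounded_measurableM _ _ _ _ _ b2 bw) g2.
Qed.

(** At each small time [t] the displacement inequality bounds the integral of
    [F] over [gamma_t] from below, the integrated pressure increment bounds it
    from above, and the terms in [D0] and [D1] cancel up to order [t^2]. *)
Lemma energy_dissipation (g : X -> R) (M u delta : R) :
  Ricci_bounded_below nu N K -> (\int[nu]_x (rho x)%:E = 1)%E ->
  measurable_fun setT (g : borel X -> R) -> (forall x, 0 <= g x <= M) ->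
  0 < delta ->
  (forall x y, mdist x y < delta ->
     rho x - rho y <= g x * mdist x y /\ rho x <= u * rho y) ->
  N - N * \int[nu]_x (rho x `^ (1 - N^-1)) <=
  u ^+ 2 * ((2 * K)^-1 * (1 - N^-1) ^+ 2) *
    \int[nu]_x (rho x * fisher_density N (rho x) (g x)).
Proof.
move=> Ric rho1 mg gM delta0 slope.
have [P [h0E HT]] := displacement_inequality nu N K N1 K0 cX rho Ric rho0 crho rho1.
have bg : bounded_measurable _ (borel X) R g.
  by split=> //; exists M => x; rewrite ger0_norm; case/andP: (gM x).
have bQ := bounded_measurable_fisher g bg.
have be t (f : X -> R) : bounded_measurable _ (borel X) R f ->
    bounded_measurable _ _ R (fun z : borel (geodesic X) => f (eval_at t z)).
  by move=> bf; apply: bounded_measurable_comp bf (measurable_eval_at t).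
pose F x := rho x `^ (- N^-1).
have bF : bounded_measurable _ (borel X) R F by exact: bounded_measurable_powR.
pose dd (z : borel (geodesic X)) := mdist (gstart z : X) (gend z : X).
have [Dm Dm0 DmP] := mdist_bounded cX.
have bdd : bounded_measurable _ _ R (fun z => dd z ^+ 2).
  have bd : bounded_measurable _ _ R dd.
    split; first exact: (@measurableT_comp _ _ _ _ _ _
      (fun z : borel X * borel X => mdist (z.1 : X) (z.2 : X)) _ (@endpoints R X)
      (measurable_mdist cX) (@measurable_endpoints R X)).
    by exists Dm => z; rewrite ger0_norm ?mdist_ge0// DmP.
  exact: (bounded_measurableM _ _ _ _ _ bd bd).
pose F0 (z : borel (geodesic X)) := F (gstart z).
have bF0 : bounded_measurable _ _ R F0 by exact: be.
have bF0d := bounded_measurableM _ _ _ _ _ bF0 bdd.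
pose Q (z : borel (geodesic X)) := fisher_density N (rho (gstart z))
  (g (gstart z)).
have bQ0 : bounded_measurable _ _ R Q by exact: (be _ (fun x => fisher_density N (rho x) (g x))).
have bc (r : R) := bounded_measurable_cst _ (borel (geodesic X)) R r.
have bZ (r : R) f := bounded_measurableM _ (borel (geodesic X)) R _ f (bc r).
set A := \int[nu]_x (rho x `^ (1 - N^-1)).
pose D0 := \int[P]_z (F0 z * dd z ^+ 2); pose D1 := \int[P]_z dd z ^+ 2.
pose q := \int[P]_z Q z.
have AE : \int[P]_z F0 z = A.
  apply: EFin_inj; rewrite -!EFin_Rintegral//; last exact: bounded_measurable_powR.
  have := h0E (fun x => (F x)%:E); rewrite /= => ->.
  - apply: eq_integral => x _; rewrite -EFinM; congr EFin.
    by rewrite /F powRD ?(gt_eqF (rho0 x)) ?implybT// powRr1// ltW.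
  - by move=> x; rewrite lee_fin powR_ge0.
  - by apply/measurable_EFinP; case: bF.
have qE : q = \int[nu]_x (rho x * fisher_density N (rho x) (g x)).
  apply: EFin_inj; rewrite -!EFin_Rintegral//; last first.
    apply: bounded_measurableM => //.
    have := bounded_measurable_powR 1.
    by under eq_fun do rewrite powRr1 ?ltW//.
  have := h0E (fun x => (fisher_density N (rho x) (g x))%:E); rewrite /= => ->.
  - by apply: eq_integral => x _; rewrite -EFinM.
  - move=> x; rewrite lee_fin /fisher_density.
    by rewrite mulr_ge0 ?sqr_ge0// divr_ge0 ?sqr_ge0// ltW// weight_gt0.
  - by apply/measurable_EFinP; case: bQ.
rewrite -qE; set B := (2 * K)^-1 * _.
have D0_ge0 : 0 <= D0.
  by apply: Rintegral_ge0 => z _; rewrite mulr_ge0 ?powR_ge0 ?sqr_ge0.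
have D1_ge0 : 0 <= D1 by apply: Rintegral_ge0 => z _; rewrite sqr_ge0.
pose I (t : {i01 R}) := \int[P]_z F (eval_at t z).
have displacement (t : {i01 R}) : 0 < t%:num < 1 ->
    (1 - t%:num) * (A + (1 - (1 - t%:num) ^+ 2) * (K / (6 * N)) * D0) +
    t%:num * (1 + (1 - t%:num ^+ 2) * (K / (6 * N)) * D1) <=
    N^-1 * A + (1 - N^-1) * I t.
  move=> t01; have := HT t t01.
  pose k r := (1 - r ^+ 2) * (K / (6 * N)).
  have -> : (\int[P]_z (rho (eval_at 0%:i01 z) `^ (- N^-1) *
      distortion_weight N K (1 - t%:num) (eval_at 0%:i01 z) (eval_at 1%:i01 z))%:E)%E =
      (A + k (1 - t%:num) * D0)%:E.
    transitivity (\int[P]_z (F0 z + k (1 - t%:num) * (F0 z * dd z ^+ 2))%:E)%E.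
      apply: eq_integral => z _; congr EFin.
      by rewrite /distortion_weight /F0 /F /k /dd /gstart /gend; ring.
    rewrite EFin_Rintegral ?bounded_RintegralD ?bounded_RintegralZl ?AE//.
    + exact: bZ.
    + by apply: bounded_measurableD => //; exact: bZ.
  have -> : (\int[P]_z (distortion_weight N K t%:num
      (eval_at 0%:i01 z) (eval_at 1%:i01 z))%:E)%E = (1 + k t%:num * D1)%:E.
    transitivity (\int[P]_z (1 + k t%:num * dd z ^+ 2)%:E)%E.
      by apply: eq_integral => z _.
    rewrite EFin_Rintegral ?bounded_RintegralD ?bounded_RintegralZl
      ?Rintegral_probability_cst//.
    + exact: bZ.
    + by apply: bounded_measurableD => //; exact: bZ.
  rewrite EFin_Rintegral; last exact: bounded_measurable_powR.
  rewrite EFin_Rintegral; last exact: (be t F).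
  by rewrite -!EFinM -!EFinD lee_fin.
have pressure (t : {i01 R}) : t%:num * Dm < delta ->
    (N - 1) * I t <= (N - 1) * A +
      t%:num * (u ^+ 2 * B * q + (K / 6 * D1 + K / 3 * D0)).
  move=> tD.
  pose rhs z := (N - 1) * F0 z + t%:num *
    (u ^+ 2 * B * Q z + (K / 6 * dd z ^+ 2 + K / 3 * (F0 z * dd z ^+ 2))).
  have b1 := bZ (K / 6) _ bdd; have b2 := bZ (K / 3) _ bF0d.
  have b3 := bounded_measurableD _ _ _ _ _ b1 b2.
  have b4 := bZ (u ^+ 2 * B) _ bQ0.
  have b5 := bounded_measurableD _ _ _ _ _ b4 b3.
  have b6 := bZ t%:num _ b5; have b7 := bZ (N - 1) _ bF0.
  have bt := be t F bF.
  have -> : (N - 1) * A + t%:num * (u ^+ 2 * B * q + (K / 6 * D1 + K / 3 * D0)) =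
      \int[P]_z rhs z.
    rewrite bounded_RintegralD// !bounded_RintegralZl// AE.
    by rewrite bounded_RintegralD// bounded_RintegralZl// bounded_RintegralD//
      !bounded_RintegralZl.
  rewrite -bounded_RintegralZl//; apply: bounded_le_Rintegral.
  - exact: bZ.
  - exact: bounded_measurableD.
  - move=> z; set x : X := gstart z; set y : X := eval_at t z.
    have xy : mdist x y = t%:num * dd z.
      by rewrite mdist_eval_at/= sub0r normrN ger0_norm.
    have xyd : mdist x y < delta.
      by apply: le_lt_trans tD; rewrite xy ler_wpM2l ?DmP.
    have [s1 s2] := slope _ _ xyd; rewrite xy in s1.
    have g0 : 0 <= g x by case/andP: (gM x).
    have tge0 : 0 <= t%:num by [].
    have := pressure_increment _ N K (rho x) (rho y) (g x) t%:num (dd z) u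
      N1 K0 (rho0 x) (rho0 y) g0 tge0 (mdist_ge0 _ _) s1 s2.
    move=> /le_trans; apply; rewrite le_eqVlt; apply/orP; left; apply/eqP.
    by rewrite /rhs /F0 /F /Q -/x /weight -/B; field.
have key (t : {i01 R}) : 0 < t%:num < 1 -> t%:num * Dm < delta ->
    N - N * A <= u ^+ 2 * B * q + t%:num * (K / 6 * (3 * D0 + D1)).
  move=> t01 tD; have /andP[t0 t1] := t01.
  have h1 := displacement t t01; have h2 := pressure t tD.
  have {}h1 : (1 - t%:num) * (N * A + (1 - (1 - t%:num) ^+ 2) * (K / 6) * D0) +
      t%:num * (N + (1 - t%:num ^+ 2) * (K / 6) * D1) <= A + (N - 1) * I t.
    have := ler_wpM2l (ltW N0) h1.
    rewrite [X in X <= _ -> _](_ : _ = (1 - t%:num) * (N * A +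
      (1 - (1 - t%:num) ^+ 2) * (K / 6) * D0) +
      t%:num * (N + (1 - t%:num ^+ 2) * (K / 6) * D1)); last first.
      by field; rewrite gt_eqF.
    rewrite [X in _ <= X -> _](_ : _ = A + (N - 1) * I t)//.
    by field; rewrite gt_eqF.
  have h3 : t%:num * (N - N * A) <= t%:num * (u ^+ 2 * B * q) +
      t%:num ^+ 2 * (K / 6 * ((3 - t%:num) * D0 + t%:num * D1)).
    have := le_trans h1 (lerD (lexx A) h2).
    by move: (u ^+ 2 * B * q) => Y; lra.
  have h4 : t%:num ^+ 2 * (K / 6 * ((3 - t%:num) * D0 + t%:num * D1)) <=
      t%:num ^+ 2 * (K / 6 * (3 * D0 + D1)).
    rewrite ler_wpM2l ?sqr_ge0// ler_wpM2l ?divr_ge0 ?(ltW K0)// lerD//.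
      by rewrite ler_wpM2r// gerBl ltW.
    by rewrite ler_piMl// ltW.
  rewrite -(ler_pM2l t0); apply: le_trans h3 _; rewrite [leRHS]mulrDr lerD2l.
  by apply: le_trans h4 _; rewrite expr2 -mulrA.
apply/ler_addgt0Pr => e e0.
pose C := K / 6 * (3 * D0 + D1).
have C0 : 0 <= C by rewrite mulr_ge0 ?divr_ge0 ?(ltW K0)// addr_ge0// mulr_ge0.
(* The three bounds ensure t < 1, that geodesics move less than delta by time t,
   and that the error term is at most e. *)
pose t := Num.min 2^-1 (Num.min (delta / (2 * Dm)) (e / (C + 1))).
have t0 : 0 < t.
  by rewrite !lt_min invr_gt0 ltr0n !divr_gt0 ?mulr_gt0// ltr_wpDl.
have t1 : t < 1 by rewrite gt_min invf_lt1 ?ltr1n.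
have tD : t * Dm < delta.
  rewrite -ltr_pdivlMr//; apply: (@le_lt_trans _ _ (delta / (2 * Dm))).
    by rewrite !ge_min lexx orbT.
  rewrite ltr_pM2l// ltf_pV2 ?posrE ?mulr_gt0//; lra.
have tC : t * C <= e.
  have h : t <= e / (C + 1) by rewrite !ge_min lexx !orbT.
  have : t * (C + 1) <= e by rewrite -ler_pdivlMr// ltr_wpDl.
  by apply: le_trans; rewrite ler_wpM2l ?(ltW t0)// lerDl.
have := key (Itv01 (ltW t0) (ltW t1)); rewrite /= t0 t1 => /(_ isT tD).
by move=> /le_trans; apply; rewrite lerD2l.
Qed.

End dissipation.

(** * Perturbation of the density *)

Section fisher_density_scaling.
Context {R : realType}.
Implicit Types N r k S : R.

Lemma fisher_densityE N r S : 0 < r ->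
  r * fisher_density N r S = r `^ (- 1 - 2 / N) / weight N r * S ^+ 2.
Proof.
move=> r0; have rN0 : r != 0 by rewrite gt_eqF.
have -> : - 1 - 2 / N = - 1 + (- N^-1 + - N^-1) by ring.
rewrite !powRD ?rN0 ?implybT// powR_inv1 ?ltW// /fisher_density.
by field; rewrite rN0 gt_eqF// weight_gt0.
Qed.

(** With [F = r^(-1/N)], the Fisher density is [F^2 / (1/3 + 2/3 F) / r^2] times
    the squared slope. Passing from [r] to [r' >= r / k] multiplies [F] by at
    most [k] and [1 / r] by at most [k], and [x^2 / (1/3 + 2/3 x)] is
    nondecreasing, so [k^3] is lost; the slope [S / k] gains [k^2] back. *)
Lemma fisher_density_scaling N r r' k S : 1 < N -> 0 < r -> 0 < r' -> 1 <= k ->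
  r <= k * r' ->
  r' * fisher_density N r' (S / k) <= k * (r * fisher_density N r S).
Proof.
move=> N1 r0 r'0 k1 rk; have k0 : 0 < k by exact: lt_le_trans k1.
have N0 : 0 < N by exact: lt_trans N1.
set F := r `^ (- N^-1); set F' := r' `^ (- N^-1).
have F0 : 0 < F by exact: powR_gt0.
have F'0 : 0 < F' by exact: powR_gt0.
have FF' : F' <= k * F.
  apply: (@le_trans _ _ (k `^ N^-1 * F)); last first.
    by rewrite ler_wpM2r ?(ltW F0)// ler1_powR// invf_le1// ltW.
  rewrite /F /F' !powRN -ler_pdivrMl ?powR_gt0// -invfM -powRM ?(ltW k0) ?(ltW r'0)//.
  rewrite lef_pV2 ?posrE ?powR_gt0 ?mulr_gt0//.
  by apply: ge0_ler_powR => //;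
    rewrite ?nnegrE ?invr_ge0 ?mulr_ge0 ?(ltW N0) ?(ltW r0) ?(ltW k0) ?(ltW r'0).
have w0 := weight_gt0 N r; have w'0 := weight_gt0 N r'.
have wE : weight N r = 3^-1 + 2 / 3 * F by [].
have w'E : weight N r' = 3^-1 + 2 / 3 * F' by [].
have Fw : F' ^+ 2 / weight N r' <= k ^+ 2 * (F ^+ 2 / weight N r).
  rewrite ler_pdivrMr// mulrA mulrAC ler_pdivlMr// wE w'E.
  have h1 : F' ^+ 2 <= (k * F) ^+ 2.
    by rewrite ler_sqr ?nnegrE ?mulr_ge0 ?(ltW F'0) ?(ltW k0) ?(ltW F0).
  have h2 : F' ^+ 2 * F <= (k * F) ^+ 2 * F'.
    have -> : F' ^+ 2 * F = F' * F * F' by ring.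
    have -> : (k * F) ^+ 2 * F' = F' * F * (k * (k * F)) by ring.
    rewrite ler_wpM2l ?mulr_ge0 ?(ltW F'0) ?(ltW F0)//; apply: le_trans FF' _.
    by rewrite ler_peMl ?mulr_ge0 ?(ltW k0) ?(ltW F0).
  have -> : F' ^+ 2 * (3^-1 + 2 / 3 * F) = F' ^+ 2 / 3 + 2 / 3 * (F' ^+ 2 * F) by ring.
  have -> : k ^+ 2 * F ^+ 2 * (3^-1 + 2 / 3 * F') =
    (k * F) ^+ 2 / 3 + 2 / 3 * ((k * F) ^+ 2 * F') by ring.
  by move: h1 h2; lra.
have -> : r' * fisher_density N r' (S / k) =
    F' ^+ 2 / weight N r' * r'^-1 * (S ^+ 2 / k ^+ 2).
  by rewrite /fisher_density -/F'; field; rewrite !gt_eqF.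
have -> : k * (r * fisher_density N r S) =
    k ^+ 2 * (F ^+ 2 / weight N r) * (k / r) * (S ^+ 2 / k ^+ 2).
  by rewrite /fisher_density -/F; field; rewrite !gt_eqF.
rewrite ler_wpM2r ?divr_ge0 ?sqr_ge0//.
apply: ler_pM => //; first by rewrite divr_ge0 ?sqr_ge0// ltW.
  by rewrite invr_ge0 ltW.
by rewrite ler_pdivlMr// mulrC ler_pdivrMr.
Qed.

(** Each summand [x <= m = a + b] satisfies [m^p * (x / m) <= x^p], because
    [x / m <= 1]. *)
Lemma powRD_le (p a b : R) : 0 < p <= 1 -> 0 <= a -> 0 <= b ->
  (a + b) `^ p <= a `^ p + b `^ p.
Proof.
move=> /andP[p0 p1] a0 b0.
have [->|a0'] := eqVneq a 0; first by rewrite add0r lerDr powR_ge0.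
have [->|b0'] := eqVneq b 0; first by rewrite addr0 lerDl powR_ge0.
have {}a0 : 0 < a by rewrite lt_def a0'.
have {}b0 : 0 < b by rewrite lt_def b0'.
set m := a + b; have m0 : 0 < m by rewrite addr_gt0.
have part x : 0 < x -> x <= m -> m `^ p * (x / m) <= x `^ p.
  move=> x0 xm; have -> : x `^ p = m `^ p * (x / m) `^ p.
    by rewrite -powRM ?divr_ge0 ?ltW// mulrCA divff ?mulr1 ?gt_eqF.
  rewrite ler_pM2l ?powR_gt0//; apply: ger1_powR => //.
  by rewrite divr_gt0//= ler_pdivrMr// mul1r.
have -> : m `^ p = m `^ p * (a / m) + m `^ p * (b / m).
  by rewrite -mulrDr -mulrDl divff ?mulr1// gt_eqF.
by rewrite lerD// part// /m ?lerDl ?lerDr ltW.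
Qed.

End fisher_density_scaling.

(** * Passage to the limit *)

Section bounded_convergence.
Context d (T : measurableType d) (R : realType).

Lemma bounded_convergence (P : probability T R) (f_ : nat -> T -> R) (f : T -> R) (M : R) :
  (forall n, measurable_fun setT (f_ n)) -> (forall n x, `|f_ n x| <= M) ->
  (forall x, f_ ^~ x @ \oo --> f x) ->
  \int[P]_x f_ n x @[n --> \oo] --> \int[P]_x f x.
Proof.
move=> mf_ fM cf.
have mf : measurable_fun setT f by apply: (measurable_fun_cvg mf_) => x _; exact: cf.
have bf_ n : bounded_measurable _ T R (f_ n) by split=> //; exists M.
have fbM x : `|f x| <= M.
  have cn : (fun n => `|f_ n x|) @ \oo --> `|f x| by apply: cvg_norm; exact: cf.
  rewrite -(cvg_lim _ cn)//; apply: limr_le; first by apply/cvg_ex; eexists; exact: cn.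
  by apply: nearW.
have bf : bounded_measurable _ T R f by split=> //; exists M.
have [|||||_ _ cvg] := @dominated_convergence _ T R P setT measurableT
  (fun n x => (f_ n x)%:E) (EFin \o f) (cst M%:E).
- by move=> n; exact/measurable_EFinP.
- exact/measurable_EFinP.
- by apply: aeW => x _; apply: cvg_EFin; [exact: nearW|exact: cf].
- by apply: (bounded_measurable_integrable _ _ _ P (cst M)); exact: bounded_measurable_cst.
- by apply: aeW => x n _ /=; rewrite lee_fin.
have := cvg; rewrite EFin_Rintegral//; exact: fine_cvg.
Qed.

End bounded_convergence.

Section positive_density.
Context {R : realType} {X : pmetricType R}.
Variables (nu : probability (borel X) R) (N K : R).
Hypotheses (N1 : 1 < N) (K0 : 0 < K) (cX : compact [set: X]).
Hypothesis Ric : Ricci_bounded_below nu N K.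

Lemma entropy_le_fisher (rho : X -> R) (c M : R) (g : nat -> X -> R) (S : X -> R) :
  0 < c -> (forall x, c <= rho x) -> continuous rho ->
  (\int[nu]_x (rho x)%:E = 1)%E ->
  (forall n, measurable_fun setT (g n : borel X -> R)) ->
  (forall n x, 0 <= g n x <= M) ->
  (forall n x y, mdist x y < n.+1%:R^-1 -> rho x - rho y <= g n x * mdist x y) ->
  (forall x, g ^~ x @ \oo --> S x) ->
  N - N * \int[nu]_x (rho x `^ (1 - N^-1)) <=
  (2 * K)^-1 * (1 - N^-1) ^+ 2 *
    \int[nu]_x (rho x * fisher_density N (rho x) (S x)).
Proof.
move=> c0 rhoc crho rho1 mg gM slope gS.
set A := \int[nu]_x _; set B := (2 * K)^-1 * _.
have rho0 x : 0 < rho x by exact: lt_le_trans (rhoc x).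
have M0 : 0 <= M by have /andP[g0 gM0] := gM 0%N point; exact: le_trans gM0.
(* At distance less than 1/(n+1), rho varies by at most M/(n+1), that is by a
   factor at most u n since rho >= c. *)
pose u (n : nat) := 1 + M / c * n.+1%:R^-1.
pose q n := \int[nu]_x (rho x * fisher_density N (rho x) (g n x)).
have step n : N - N * A <= u n ^+ 2 * B * q n.
  apply: (energy_dissipation nu N K N1 K0 cX rho c c0 rhoc crho (g n) M (u n)
    n.+1%:R^-1) => // x y xy; split; first exact: slope.
  rewrite /u mulrDl mul1r -lerBlDl; apply: le_trans (slope n x y xy) _.
  apply: (@le_trans _ _ (M * n.+1%:R^-1)).
    by apply: ler_pM; rewrite ?mdist_ge0 ?(ltW xy)//; case/andP: (gM n x).
  rewrite -mulrA [X in _ <= X]mulrC mulrA -[X in X <= _]mulr1.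
  rewrite [X in _ <= X](_ : _ = M * n.+1%:R^-1 * (rho y / c)); last first.
    by field; rewrite ?pnatr_eq0 ?gt_eqF//.
  by rewrite ler_wpM2l ?mulr_ge0// ler_pdivlMr// mul1r.
have cu : u n @[n --> \oo] --> (1 : R).
  rewrite -[X in _ --> X]addr0; apply: cvgD; first exact: cvg_cst.
  rewrite -[X in _ --> X](mulr0 (M / c)); apply: cvgM; first exact: cvg_cst.
  exact: cvg_harmonic.
have bh : bounded_measurable _ (borel X) R (fun x => rho x * fisher_density N (rho x) 1).
  apply: bounded_measurableM.
    have := bounded_measurable_powR cX rho c c0 rhoc crho 1.
    by under eq_fun do rewrite powRr1 ?ltW//.
  apply: (bounded_measurable_fisher N cX rho c c0 rhoc crho).
  exact: bounded_measurable_cst.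
have fE r s : r * fisher_density N r s = r * fisher_density N r 1 * s ^+ 2.
  by rewrite /fisher_density expr1n mulr1 mulrA.
have cq : q n @[n --> \oo] --> \int[nu]_x (rho x * fisher_density N (rho x) (S x)).
  have [mh [H hH]] := bh.
  apply: (bounded_convergence _ _ _ _ _ _ (H * M ^+ 2)).
  - move=> n; rewrite (_ : (fun x => _) =
      (fun x : borel X => rho x * fisher_density N (rho x) 1 * g n x ^+ 2)); last first.
      by apply/funext => x; rewrite fE.
    by apply: measurable_funM => //; apply: measurable_funX.
  - move=> n x; rewrite fE normrM ler_pM// ger0_norm ?sqr_ge0//.
    by have /andP[g0 gMn] := gM n x; rewrite ler_sqr ?nnegrE.
  - move=> x; rewrite fE; under eq_fun do rewrite fE.
    by apply: cvgM; [exact: cvg_cst|exact: (cvgM (gS x) (gS x))].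
have lim : (u n ^+ 2 * B * q n) @[n --> \oo] -->
    B * \int[nu]_x (rho x * fisher_density N (rho x) (S x)).
  apply: cvgM => //; rewrite -[X in _ --> X]mul1r -(expr1n _ 2).
  by apply: cvgM; [exact: (cvgM cu cu)|exact: cvg_cst].
rewrite -(cvg_lim _ lim)//; apply: limr_ge; first by apply/cvg_ex; eexists; exact: lim.
exact: nearW.
Qed.

End positive_density.

Theorem theorem5p26 (R : realType) (X : pmetricType R)
    (nu : probability (borel X) R) (N K : R) :
  1 < N -> 0 < K ->
  compact [set: X] -> length_metric X ->
  Ricci_bounded_below nu N K ->
  forall rho0 : X -> R,
  (forall x, 0 <= rho0 x) -> lipschitz_fun rho0 ->
  (\int[nu]_x (rho0 x)%:E = 1)%E ->
  (N%:E - N%:E * \int[nu]_x (rho0 x `^ (1 - N^-1))%:E <=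
   ((2 * K)^-1 * ((N - 1) / N) ^+ 2)%:E *
   \int[nu]_x (if rho0 x == 0%R then 0 else
     (rho0 x `^ (- 1 - 2 / N) / (3^-1 + 2 / 3 * rho0 x `^ (- N^-1)))%:E *
     desc_slope rho0 x ^+ 2))%E.
Proof.
move=> N1 K0 cX _ Ric rho0 rho_ge0 [L lip] rho_int.
have N0 : 0 < N by exact: lt_trans N1.
have s0 : 0 < 1 - N^-1 by rewrite subr_gt0 invf_lt1.
have crho : continuous rho0 by exact: lipschitz_continuous lip.
have mrho : measurable_fun setT (rho0 : borel X -> R) by exact: measurable_continuous.
have [M M0 rhoM] := continuous_bounded cX rho0 crho.
pose g n := descent_rate rho0 n.
pose S x := limn (g ^~ x).
have gS x : g ^~ x @ \oo --> S x by exact: is_cvg_descent_rate lip x.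
have S0 x : 0 <= S x by exact: lim_descent_rate_ge0 lip x.
have Sz x : rho0 x = 0 -> S x = 0.
  move=> x0; rewrite /S; apply: cvg_lim => //.
  rewrite (_ : g ^~ x = fun=> 0); first exact: cvg_cst.
  by apply/funext => n; apply: (descent_rate_min _ _ lip) => y; rewrite x0.
have mS : measurable_fun setT (S : borel X -> R).
  apply: (measurable_fun_cvg (h := g : nat -> borel X -> R)) => [n|x _]; last exact: gS.
  exact: measurable_descent_rate lip n.
set A := (\int[nu]_x (rho0 x `^ (1 - N^-1))%:E)%E.
set B := (2 * K)^-1 * ((N - 1) / N) ^+ 2.
have BE : B = (2 * K)^-1 * (1 - N^-1) ^+ 2.
  by rewrite /B; congr (_ * _ ^+ 2); field; rewrite gt_eqF.
have B0 : 0 < B.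
  by rewrite BE mulr_gt0 ?exprn_gt0// invr_gt0 mulr_gt0.
have bA : bounded_measurable _ (borel X) R (fun x => rho0 x `^ (1 - N^-1)).
  split; first exact: measurableT_comp (measurable_powR _) _.
  exists (M `^ (1 - N^-1)) => x; rewrite ger0_norm ?powR_ge0//.
  by apply: ge0_ler_powR; rewrite ?nnegrE ?(ltW s0)// (le_trans (ler_norm _)).
(* psi vanishes where rho0 does: such a point is a minimum of rho0, so S = 0. *)
pose psi x := rho0 x `^ (- 1 - 2 / N) / weight N (rho0 x) * S x ^+ 2.
have psi0 x : 0 <= psi x.
  by rewrite mulr_ge0 ?sqr_ge0// divr_ge0 ?powR_ge0// ltW// weight_gt0.
have mpsi : measurable_fun setT (fun x : borel X => (psi x)%:E).
  apply/measurable_EFinP; apply: measurable_funM; last exact: measurable_funX.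
  apply: measurable_funM; last exact: measurable_weightV.
  exact: measurableT_comp (measurable_powR _) _.
have le_psi : (\int[nu]_x (psi x)%:E <= \int[nu]_x (if rho0 x == 0%R then 0 else
     (rho0 x `^ (- 1 - 2 / N) / (3^-1 + 2 / 3 * rho0 x `^ (- N^-1)))%:E *
     desc_slope rho0 x ^+ 2))%E.
  apply: ge0_integral_mono => x; first by rewrite lee_fin.
  case: ifPn => [/eqP x0|x0].
    by rewrite /psi Sz// expr0n/= mulr0.
  have slope := lim_descent_rate_le_slope _ _ lip x.
  rewrite /psi EFinM; apply: lee_wpmul2l.
    by rewrite lee_fin divr_ge0 ?powR_ge0// ltW// weight_gt0.
  rewrite !expe2 expr2 EFinM; apply: lee_pmul => //; rewrite lee_fin//.
apply: le_trans (lee_wpmul2l _ le_psi); last by rewrite lee_fin ltW.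
have approx (e : R) : 0 < e ->
    (N%:E - N%:E * (A + (e `^ (1 - N^-1))%:E) <=
     (B * (1 + e))%:E * \int[nu]_x (psi x)%:E)%E.
  move=> e0; pose k := 1 + e.
  have k1 : 1 <= k by rewrite lerDl ltW.
  have k0 : 0 < k by exact: lt_le_trans k1.
  (* the perturbed density is normalized because nu is a probability measure *)
  pose rho x := (rho0 x + e) / k.
  have rhoc x : e / k <= rho x by rewrite ler_pM2r ?invr_gt0// lerDr.
  have crhoe : continuous rho.
    move=> x; apply: cvgM; last exact: cvg_cst.
    by apply: cvgD; [exact: crho|exact: cvg_cst].
  have rho1 : (\int[nu]_x (rho x)%:E = 1)%E.
    transitivity (\int[nu]_x ((k^-1)%:E * ((rho0 x)%:E + e%:E)))%E.
      by apply: eq_integral => x _; rewrite -EFinD -EFinM mulrC.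
    have me : measurable_fun setT (EFin \o rho0 : borel X -> \bar R) by exact/measurable_EFinP.
    rewrite ge0_integralZl_EFin//.
    - rewrite ge0_integralD//; last 2 first.
        by move=> x _; rewrite lee_fin.
        by move=> x _; rewrite lee_fin ltW.
      rewrite rho_int integral_cst// (_ : (e%:E * _)%E = e%:E).
        by rewrite -EFinD -EFinM mulVf// gt_eqF.
      by rewrite -[RHS]mule1; congr (_ * _)%E; exact: probability_setT.
    - by move=> x _; rewrite -EFinD lee_fin addr_ge0// ltW.
    - exact: emeasurable_funD.
    - by rewrite invr_ge0 ltW.
  have main : N - N * \int[nu]_x (rho x `^ (1 - N^-1)) <=
      B * \int[nu]_x (rho x * fisher_density N (rho x) (S x / k)).
    rewrite BE; apply: (entropy_le_fisher nu N K N1 K0 cX Ric rho (e / k) `|L|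
      (fun n x => g n x / k) (fun x => S x / k)) => //.
    - by rewrite divr_gt0.
    - move=> n; apply: measurable_funM => //.
      exact: measurable_descent_rate lip n.
    - move=> n x; rewrite divr_ge0 ?(descent_rate_ge0 _ _ lip) ?(ltW k0)//=.
      rewrite ler_pdivrMr//; apply: le_trans (descent_rate_le _ _ lip n x) _.
      by rewrite ler_peMr.
    - move=> n x y xy; rewrite /rho -mulrBl opprD addrACA subrr addr0 mulrAC.
      by rewrite ler_pM2r ?invr_gt0//; exact: descent_rateP lip _ _ _ xy.
    - by move=> x; apply: cvgM; [exact: gS|exact: cvg_cst].
  have rhopos x : 0 < rho x by apply: lt_le_trans (rhoc x); rewrite divr_gt0.
  have brho : bounded_measurable _ (borel X) R (fun x => rho x `^ (1 - N^-1)).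
    by apply: (bounded_measurable_powR cX rho (e / k)) => //; rewrite divr_gt0.
  have A_le : \int[nu]_x (rho x `^ (1 - N^-1)) <=
      \int[nu]_x (rho0 x `^ (1 - N^-1)) + e `^ (1 - N^-1).
    have be := bounded_measurable_cst _ (borel X) R (e `^ (1 - N^-1)).
    rewrite -[X in _ <= _ + X](Rintegral_probability_cst _ _ _ nu).
    rewrite -bounded_RintegralD//; apply: bounded_le_Rintegral => //.
      exact: bounded_measurableD.
    move=> x; have s1 : 0 < 1 - N^-1 <= 1.
      by rewrite s0/= gerBl invr_ge0 ltW.
    apply: le_trans (powRD_le _ _ _ s1 (rho_ge0 x) (ltW e0)).
    apply: ge0_ler_powR; rewrite ?nnegrE ?(ltW s0) ?(ltW (rhopos x)) ?addr_ge0 ?(ltW e0)//.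
    by rewrite ler_pdivrMr// ler_peMr// addr_ge0// ltW.
  rewrite /A EFin_Rintegral// -EFinD.
  apply: (@le_trans _ _ (B * \int[nu]_x (rho x * fisher_density N (rho x) (S x / k)))%:E).
    rewrite lee_fin; apply: le_trans main; rewrite lerD2l lerN2.
    by rewrite ler_wpM2l// ltW.
  rewrite (EFinM B (1 + e)) (EFinM B) -muleA; apply: lee_wpmul2l; first by rewrite lee_fin ltW.
  rewrite -ge0_integralZl_EFin//; [|by move=> x _; rewrite lee_fin|by rewrite ltW].
  have bf : bounded_measurable _ (borel X) R
      (fun x => rho x * fisher_density N (rho x) (S x / k)).
    apply: bounded_measurableM.
      have := bounded_measurable_powR cX rho (e / k) _ rhoc crhoe 1.
      by under eq_fun do rewrite powRr1 ?ltW//; apply; rewrite divr_gt0.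
    apply: (bounded_measurable_fisher N cX rho (e / k)) => //.
      by rewrite divr_gt0.
    split; first exact: measurable_funM.
    exists (`|L| / k) => x; rewrite ger0_norm ?divr_ge0 ?(ltW k0)//.
    rewrite ler_pM2r ?invr_gt0//; apply: limr_le; first exact: is_cvg_descent_rate lip x.
    by apply: nearW => n; exact: descent_rate_le.
  rewrite -EFin_Rintegral//; apply: ge0_integral_mono => x.
    rewrite lee_fin mulr_ge0 ?(ltW (rhopos x))// /fisher_density.
    by rewrite mulr_ge0 ?sqr_ge0// divr_ge0 ?sqr_ge0// ltW// weight_gt0.
  rewrite -EFinM lee_fin /psi.
  have [x0|x0] := eqVneq (rho0 x) 0.
    by rewrite Sz// mul0r /fisher_density expr0n/= !mulr0.
  have rx : 0 < rho0 x by rewrite lt_def x0 rho_ge0.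
  rewrite -fisher_densityE//; apply: fisher_density_scaling => //.
  by rewrite /rho mulrCA divff ?mulr1 ?lerDl ?ltW// gt_eqF.
have psi_ge0 : (0 <= \int[nu]_x (psi x)%:E)%E.
  by apply: integral_ge0 => x _; rewrite lee_fin.
move: psi_ge0 approx; rewrite /A (EFin_Rintegral _ _ _ nu _ bA).
set a := \int[nu]_x _; case: (\int[nu]_x (psi x)%:E)%E => [r| |] //.
- rewrite lee_fin => r0 approx.
  change ((N - N * a)%:E <= (B * r)%:E)%E; rewrite lee_fin.
  have {}approx (e : R) : 0 < e ->
      N - N * (a + e `^ (1 - N^-1)) <= B * (1 + e) * r.
    by move=> /approx.
  have c1 : (N - N * (a + e `^ (1 - N^-1))) @[e --> 0^'+] --> N - N * a.
    apply: cvgB; first exact: cvg_cst.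
    apply: cvgM; first exact: cvg_cst.
    rewrite -[X in _ --> X]addr0; apply: cvgD; first exact: cvg_cst.
    exact: powR_cvg0.
  have c2 : (B * (1 + e) * r) @[e --> 0^'+] --> B * r.
    apply: cvgM; last exact: cvg_cst.
    rewrite -[X in _ --> X]mulr1; apply: cvgM; first exact: cvg_cst.
    rewrite -[X in _ --> X]addr0; apply: cvgD; first exact: cvg_cst.
    by apply: cvg_at_right_filter; exact: cvg_id.
  apply: ler_cvg_to c1 c2 _.
  by near=> e; apply: approx; near: e; exact: nbhs_right_gt.
- by move=> _ _; rewrite gt0_muley ?leey// lte_fin.
Unshelve. all: by end_near. Qed.
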